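(* Let $d\ge1$ be an integer. Let $\eta,\eta_1,\eta_2,\ldots$ be i.i.d. real random variables, where $\eta$ has a probability density on $\mathbb{R}$, let $X=(\eta_1,\eta_2,\ldots)$, with law $\mu$ on $\mathbb{R}^\infty$, and let $X_j=(\eta_{1,j},\eta_{2,j},\ldots)$, $j\ge1$, be i.i.d. copies of $X$ on a probability space $(\Omega,\mathcal{F},P)$. Let $\theta_k(x)=(x_{(k-1)d+1},\ldots,x_{kd})$ for $x\in\mathbb{R}^\infty$, $k\ge1$, and $\Theta=\{\theta_k:k\ge1\}$. Then $\{\theta_k(X):k\ge1\}$ are i.i.d. $\mathbb{R}^d$-valued random vectors with absolutely continuous distribution $Q$ on $\mathbb{R}^d$, and for every $a=(a_1,\ldots,a_d,a_1,\ldots,a_d,\ldots)\in\mathbb{R}^\infty$ we have $$D_\Theta(a,\mu)=\inf_{k\ge1}P\big(\theta_k(a)\in\mathrm{co}(\theta_k(X_1),\ldots,\theta_k(X_{d+1}))\big)=\lambda(a).$$ Furthermore, for each $k\ge1$ we have with $P$-probability one that $$\lim_{n\to\infty}\Big|\frac{Z_{n,k}(a)}{N_{n,d}}-\lambda(a)\Big|=0,$$ but, for every $n\ge d+1$, with probability one $$|D_{\Theta,n}(a)-D_\Theta(a,\mu)|=\Big|\inf_{k\ge1}\frac{Z_{n,k}(a)}{N_{n,d}}-\lambda(a)\Big|=\lambda(a).$$ Hence, if $\lambda(a)>0$, the empirical simplicial depth $D_{\Theta,n}(a)$ fails to approximate the true depth $D_\Theta(a,\mu)$ as $n\to\infty$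.
   Context: For $x\in\mathbb{R}^d$ and a Borel probability $Q$ on $\mathbb{R}^d$, the simplicial depth is $D_d(x,Q)=P(x\in\mathrm{co}(Y_1,\ldots,Y_{d+1}))$, where $Y_1,\ldots,Y_{d+1}$ are i.i.d. with law $Q$ and $\mathrm{co}(\cdot)$ denotes the open convex hull (interior of the convex hull in $\mathbb{R}^d$). For $a\in\mathbb{R}^\infty$, $D_\Theta(a,\mu)=\inf_{\theta\in\Theta}D_d(\theta(a),\mu^\theta)$, where $\mu^\theta(A)=\mu(\theta^{-1}(A))$ for Borel $A\subseteq\mathbb{R}^d$. For $a=(a_1,\ldots,a_d,a_1,\ldots,a_d,\ldots)$ one has $\theta_k(a)=(a_1,\ldots,a_d)$ for all $k$, the probability $P(\theta_k(a)\in\mathrm{co}(\theta_k(X_{u+1}),\ldots,\theta_k(X_{u+d+1})))$ does not depend on $k\ge1$ or $u\ge0$, and its common value is denoted $\lambda(a)$. Further, $$Z_{n,k}(a)=\sum_{1\le j_1<\cdots<j_{d+1}\le n}I\big(\theta_k(a)\in\mathrm{co}(\theta_k(X_{j_1}),\ldots,\theta_k(X_{j_{d+1}}))\big),$$ $N_{n,d}=\frac{n!}{(d+1)!(n-d-1)!}$, and the empirical depth is $D_{\Theta,n}(a)=\inf_{k\ge1}\frac{Z_{n,k}(a)}{N_{n,d}}$. *)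

(* Defs.v *)
From HB Require Import structures.
From mathcomp Require Import all_boot all_order all_algebra.
From mathcomp Require Import all_classical all_reals all_analysis.

Set Implicit Arguments.
Unset Strict Implicit.
Unset Printing Implicit Defensive.

Import Order.TTheory GRing.Theory Num.Theory.
Import numFieldNormedType.Exports.

Local Open Scope classical_set_scope.
Local Open Scope ring_scope.

(* Borel sigma-algebra of the matrix topology; R^d is 'rV[R]_d. *)
HB.instance Definition _ (R : realType) (m n : nat) :=
  @isMeasurable.Build (sigma_display (@open 'M[R]_(m, n))) 'M[R]_(m, n)
    <<s @open 'M[R]_(m, n) >>
    (@sigma_algebra0 _ setT _) (@sigma_algebraC _ _)
    (@sigma_algebra_bigcup _ setT _).

Lemma measurable_row d (T : measurableType d) (R : realType) (n : nat)
    (f : T -> 'rV[R]_n) :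
  (forall i, measurable_fun setT (fun x => f x 0 i)) -> measurable_fun setT f.
Proof.
move=> mf.
apply: (@measurability _ _ _ _ _ _ (@open 'rV[R]_n)) => //.
move=> _ [U oU <-]; rewrite setTI.
pose box (q : 'rV[rat]_n * rat) : set 'rV[R]_n :=
  [set y | forall i, `|ratr (q.1 0 i) - y 0 i| < ratr q.2].
have UE : U = \bigcup_(q in setT)
    (if `[< box q `<=` U >] then box q else set0).
  apply/seteqP; split => [x Ux|x [q _]]; last first.
    by case: asboolP => // sub bx; exact: sub.
  have /nbhs_ballP[e /= e0 xeU] : nbhs x U by exact: open_nbhs_nbhs.
  have /rat_in_itvoo[r] : 0 < e / 2 by rewrite divr_gt0.
  rewrite in_itv/= => /andP[r0 re].
  have /choice[q hq] : forall i, exists q : rat, `|ratr q - x 0 i| < ratr r.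
    move=> i; have /rat_in_itvoo[q] : x 0 i - ratr r < x 0 i + ratr r.
      by rewrite ltrD2l gt0_cp.
    by rewrite in_itv/= => h; exists q; rewrite distrC ltr_distlC.
  exists (\row_i q i, r) => //.
  have bx : box (\row_i q i, r) x by move=> i /=; rewrite mxE.
  case: asboolP => // -[]; move=> y yq; apply: xeU; split => // i j.
  rewrite [i]ord1 /ball/=.
  have := yq j; rewrite /= mxE => h1.
  rewrite (_ : x 0 j - y 0 j = (ratr (q j) - y 0 j) - (ratr (q j) - x 0 j));
    last by rewrite opprB [RHS]addrC subrKA.
  apply: (le_lt_trans (ler_normB _ _)).
  by rewrite [e]splitr ltrD// ?(lt_trans h1)// (lt_trans (hq j)).
rewrite UE preimage_bigcup.
apply: countable_bigcupT_measurable; first exact: countableP.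
move=> q; case: asboolP => _; last by rewrite preimage_set0.
rewrite (_ : _ @^-1` _ = \bigcap_(i in [set: 'I_n])
    ((fun x => f x 0 i) @^-1` ball (ratr (q.1 0 i) : R) (ratr q.2))); last first.
  by apply/seteqP; split => x /= h i; [move=> _|]; exact: h.
apply: fin_bigcap_measurable => // i _.
rewrite -[X in measurable X]setTI; apply: mf => //.
by apply: measurable_realfun.open_measurable; exact: ball_open.
Qed.

Section sequence_space.
Context (R : realType).

(* The product sigma-algebra on R^oo, generated by the cylinders over one
   coordinate. Coordinates are indexed from 0. *)
Definition cylinders : set (set (nat -> R)) :=
  [set A | exists i, exists2 B, measurable B &
    A = (fun x : nat -> R => x i) @^-1` B].

Definition Rinf : Type := g_sigma_algebraType cylinders.

HB.instance Definition _ := Measurable.on Rinf.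

Lemma measurable_coord (i : nat) :
  measurable_fun [set: Rinf] (fun x : Rinf => x i : R).
Proof.
move=> _ B mB; rewrite setTI; apply: sub_sigma_algebra.
by exists i; exists B.
Qed.

(* The k-th block of d consecutive coordinates; blocks are numbered from 0. *)
Definition theta_fun (d k : nat) (x : Rinf) : 'rV[R]_d :=
  \row_(i < d) x (k * d + i)%N.

Lemma measurable_theta_fun (d k : nat) : measurable_fun setT (theta_fun d k).
Proof.
apply: measurable_row => i.
rewrite (_ : (fun _ => _) = (fun x : Rinf => x (k * d + i)%N)).
  exact: measurable_coord.
by apply/funext => x; rewrite mxE.
Qed.

HB.instance Definition _ (d k : nat) :=
  isMeasurableFun.Build _ _ _ _ (theta_fun d k) (@measurable_theta_fun d k).

Definition theta (d k : nat) : {mfun Rinf >-> 'rV[R]_d} := theta_fun d k.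

End sequence_space.

Section tuple_cons_measure.
Context d (T : measurableType d) (R : realType) (n : nat).
Variable m1 : {sigma_finite_measure set T -> \bar R}.
Variable m2 : {sigma_finite_measure set (n.-tuple T) -> \bar R}.

Definition tuple_cons (x : T * n.-tuple T) : n.+1.-tuple T :=
  [tuple of x.1 :: x.2].

Lemma measurable_tuple_cons : measurable_fun setT tuple_cons.
Proof.
by apply: measurable_cons; [exact: measurable_fst|exact: measurable_snd].
Qed.

(* Sigma-finiteness is reproved here from m1 and m2: on m1 \x m2 the
   sigma-finite structure inferred by the library is the one that requires
   subprobabilities. *)
Definition tuple_cons_measure : set (n.+1.-tuple T) -> \bar R :=
  pushforward (m1 \x m2)%E tuple_cons.

Let tuple_cons_measure0 : tuple_cons_measure set0 = 0%E.
Proof. by rewrite /tuple_cons_measure /pushforward preimage_set0 measure0. Qed.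

Let tuple_cons_measure_ge0 A : (0 <= tuple_cons_measure A)%E.
Proof. by rewrite /tuple_cons_measure /pushforward measure_ge0. Qed.

Let tuple_cons_measure_sigma_additive : semi_sigma_additive tuple_cons_measure.
Proof.
pose M : {measure set _ -> \bar R} :=
  measure_function_pushforward__canonical__measure_function_Measure
    (m1 \x m2)%E measurable_tuple_cons.
exact: (@measure_semi_sigma_additive _ _ _ M).
Qed.

HB.instance Definition _ := isMeasure.Build _ _ _ tuple_cons_measure
  tuple_cons_measure0 tuple_cons_measure_ge0 tuple_cons_measure_sigma_additive.

Let tuple_cons_measure_sigma_finite : sigma_finite setT tuple_cons_measure.
Proof.
have /sigma_finiteP[F [TF ndF Foo]] := sigma_finiteT m1.
have /sigma_finiteP[G [TG ndG Goo]] := sigma_finiteT m2.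
have mbehead : measurable_fun setT
    (fun t : n.+1.-tuple T => [tuple of behead t]) := @measurable_behead _ T n.
pose H i := [set t : n.+1.-tuple T | F i (thead t)] `&`
  [set t : n.+1.-tuple T | G i [tuple of behead t]].
exists H.
  apply/seteqP; split => // t _.
  have : [set: T] (thead t) by [].
  rewrite TF => -[i _ Fi].
  have : [set: n.-tuple T] [tuple of behead t] by [].
  rewrite TG => -[j _ Gj].
  exists (maxn i j) => //; split.
    by move: Fi; apply: (subsetPset _ _ (ndF _ _ _)); exact: leq_maxl.
  by move: Gj; apply: (subsetPset _ _ (ndG _ _ _)); exact: leq_maxr.
move=> i; have [mF Fi] := Foo i; have [mG Gi] := Goo i; split.
  apply: measurableI; rewrite -[X in measurable X]setTI.
    exact: (@measurable_tnth _ T n.+1 ord0 measurableT (F i) mF).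
  exact: mbehead.
rewrite /tuple_cons_measure /pushforward.
rewrite (_ : tuple_cons @^-1` H i = F i `*` G i); last first.
  apply/seteqP; split => -[x t]; rewrite /H /=.
    by have -> : [tuple of behead (tuple_cons (x, t))] = t by exact: val_inj.
  by have -> : [tuple of behead (tuple_cons (x, t))] = t by exact: val_inj.
have : (m1 (F i) * m2 (G i) < +oo)%E.
  by rewrite lte_mul_pinfty// ge0_fin_numE.
by rewrite -(product_measure1E m1 m2 mF mG).
Qed.

HB.instance Definition _ := Measure_isSigmaFinite.Build _ _ _ tuple_cons_measure
  tuple_cons_measure_sigma_finite.

End tuple_cons_measure.

Section power_measure.
Context d (T : measurableType d) (R : realType).
Variable mu : {sigma_finite_measure set T -> \bar R}.

(* The n-fold product measure of mu. *)
Fixpoint power_measure (n : nat) :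
    {sigma_finite_measure set (n.-tuple T) -> \bar R} :=
  match n with
  | 0 => @dirac _ (0.-tuple T) [tuple] R
  | m.+1 => tuple_cons_measure mu (power_measure m)
  end.

End power_measure.

(* Lebesgue measure on R^d, as the image of the d-fold product measure. *)
Definition lebesgue_rV (R : realType) (d : nat) : set 'rV[R]_d -> \bar R :=
  pushforward (power_measure (@lebesgue_measure R) d)
    (fun t => \row_(i < d) tnth t i).
Arguments lebesgue_rV : clear implicits.

Definition mutually_independent d d' (T : measurableType d)
    (T' : measurableType d') (R : realType) (P : probability T R)
    (I : eqType) (X : I -> T -> T') : Prop :=
  forall (J : seq I) (A : I -> set T'), uniq J ->
    (forall i, measurable (A i)) ->
    (P (\bigcap_(i in [set` J]) (X i @^-1` A i)) =
     \prod_(i <- J) P (X i @^-1` A i))%E.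

Definition identically_distributed d d' (T : measurableType d)
    (T' : measurableType d') (R : realType) (P : probability T R)
    (I : Type) (X : I -> T -> T') : Prop :=
  forall i j A, measurable A -> P (X i @^-1` A) = P (X j @^-1` A).

Definition has_density d (T : measurableType d) (R : realType)
    (P : probability T R) (X : T -> R) : Prop :=
  exists f : R -> R, [/\ measurable_fun setT f, forall x, 0 <= f x &
    forall A, measurable A ->
      P (X @^-1` A) = (\int[lebesgue_measure]_(x in A) (f x)%:E)%E].

Section simplicial_depth.
Context (R : realType) (d : nat).

Definition convex_hull (I : finType) (y : I -> 'rV[R]_d) : set 'rV[R]_d :=
  [set x | exists w : I -> R, [/\ forall i, 0 <= w i, \sum_i w i = 1 &
    x = \sum_i w i *: y i]].

Definition open_hull (I : finType) (y : I -> 'rV[R]_d) : set 'rV[R]_d :=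
  (convex_hull y)°.

(* The i.i.d. sample of law Q is realized canonically, as the coordinates of
   (R^d)^(d+1) under the (d+1)-fold product of Q. *)
Definition simplicial_depth (x : 'rV[R]_d) (Q : probability 'rV[R]_d R) : R :=
  fine (power_measure Q d.+1 [set y | open_hull (tnth y) x]).

Definition depth_Theta (Theta : set {mfun Rinf R >-> 'rV[R]_d})
    (a : Rinf R) (mu : probability (Rinf R) R) : R :=
  inf [set simplicial_depth (th a) (distribution mu th) | th in Theta].

End simplicial_depth.

(* The sample points and the blocks are numbered from 0. *)
Section empirical_depth.
Context (R : realType) d0 (Omega : measurableType d0).
Variables (d : nat) (P : probability Omega R).
Variables (X : nat -> {RV P >-> Rinf R}) (a : Rinf R).

(* The event that theta_k(a) lies in the open simplex spanned by the
   theta_k(X_j) for the d+1 consecutive indices j starting at u. *)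
Definition hit_event (k u : nat) : set Omega :=
  [set w | open_hull (fun i : 'I_d.+1 => theta R d k (X (u + i)%N w))
             (theta R d k a)].

(* The probability of hit_event k u at k = u = 0; for periodic a and an i.i.d.
   sample of a sequence with i.i.d. entries it does not depend on k and u. *)
Definition lambda_ : R := fine (P (hit_event 0%N 0%N)).

Definition Z_ (n k : nat) (w : Omega) : R :=
  \sum_(j : {ffun 'I_d.+1 -> 'I_n} |
      [forall p : 'I_d.+1, forall q : 'I_d.+1, (p < q)%N ==> (j p < j q)%N])
    \1_(open_hull (fun i => theta R d k (X (j i) w))) (theta R d k a).

Definition N_ (n : nat) : R := 'C(n, d.+1)%:R.

Definition empirical_depth (n : nat) (w : Omega) : R :=
  inf (range (fun k => Z_ n k w / N_ n)).

End empirical_depth.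
Arguments N_ : clear implicits.

(* Main.v *)
(* theta_k(X) is a measurable image of the k-th block of d coordinates, so the
   blocks are i.i.d.; a product of laws dominated by Lebesgue measure is
   dominated by the product of the Lebesgue measures (Fubini).

   A point lies in the open simplex iff its barycentric coordinates, which are
   rational functions of the vertices, are positive; hence hitting events are
   measurable, and their probability only depends on the law of the block.

   Z_{n,k} / N_{n,d} is a U-statistic with a bounded kernel.  Two disjoint
   (d+1)-tuples give independent events, and the proportion of pairs that meet
   is at most (d+1)^2 / n, so E(Z/N - lambda)^2 <= (d+1)^2 / n.  This is
   summable along n = m^2, which gives a.s. convergence along squares; since
   Z_n is nondecreasing in n and N_{(m+1)^2} / N_{m^2} -> 1, the convergence
   extends to all n.

   For fixed n, eta_1 lies on one fixed side of a_1 with probability q > 0.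
   With probability q^n the first coordinates of the k-th blocks of X_1..X_n
   all lie on that side, and then no simplex contains theta_k(a).  These events
   are independent in k, so a.s. one of them occurs and the infimum over k is 0. *)
Require Import Defs.
From HB Require Import structures.
From mathcomp Require Import all_boot all_order all_algebra.
From mathcomp Require Import all_classical all_reals all_analysis.
From mathcomp Require Import measurable_realfun ring lra zify.
Import Order.TTheory GRing.Theory Num.Theory.
Import numFieldNormedType.Exports.
Local Open Scope classical_set_scope.
Local Open Scope ring_scope.

Set Implicit Arguments.
Unset Strict Implicit.
Unset Printing Implicit Defensive.

(** * Independence and pi-systems *)

Lemma finite_measure_unique (R : realType) d (T : measurableType d)
    (G : set (set T)) (m1 m2 : {measure set T -> \bar R}) :
  measurable = <<s G >> -> setI_closed G -> G setT -> (m1 setT < +oo)%E ->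
  (forall A, G A -> m1 A = m2 A) -> forall A, measurable A -> m1 A = m2 A.
Proof.
move=> mG IG GT m1oo m12 A mA.
by apply: (measure_unique G (fun=> setT)) => //; rewrite bigcup_const.
Qed.

Section independence.
Context (R : realType) d (T : measurableType d) (P : probability T R).

(** With [C] fixed, both sides are finite measures in [B], the right one being the law of [Y] scaled
    by the constant [P C]. Agreement on a generating pi-system then forces agreement everywhere. *)
Lemma indep_event_pi d' (T' : measurableType d') (G : set (set T'))
    (Y : T -> T') (C : set T) :
  measurable = <<s G >> -> setI_closed G -> G setT ->
  measurable_fun setT Y -> measurable C ->
  (forall B, G B -> (P (Y @^-1` B `&` C) = P (Y @^-1` B) * P C)%E) ->
  forall B, measurable B -> (P (Y @^-1` B `&` C) = P (Y @^-1` B) * P C)%E.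
Proof.
move=> mG IG GT mY mC GP B mB.
have PC : (fine (P C))%:E = P C by rewrite fineK// fin_num_measure.
pose c : {nonneg R} := NngNum (fine_ge0 (measure_ge0 P C)).
pose m1 : {measure set T' -> \bar R} :=
  measure_function_pushforward__canonical__measure_function_Measure
    (mrestr P mC) mY.
pose m2 : {measure set T' -> \bar R} :=
  mscale c (measure_function_pushforward__canonical__measure_function_Measure
    P mY).
have -> : (P (Y @^-1` B) * P C = m2 B)%E.
  by rewrite /m2 /= /mscale/= /pushforward PC muleC.
apply: (@finite_measure_unique _ _ _ G m1 m2) => //.
  apply: (@le_lt_trans _ _ 1%E); last exact: ltry.
  rewrite /m1/= /pushforward /mrestr preimage_setT setTI.
  exact: probability_le1.
move=> A GA; rewrite /m1 /m2 /= /mscale/= /pushforward /mrestr PC muleC.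
exact: GP.
Qed.

(** The sets are enlarged from [G] to all measurable sets one index at a time; [indep_event_pi]
    treats each index against the intersection of the others. *)
Lemma mutually_independent_pi d' (T' : measurableType d') (G : set (set T'))
    (I : eqType) (Y : I -> T -> T') :
  measurable = <<s G >> -> setI_closed G -> G setT ->
  (forall i, measurable_fun setT (Y i)) ->
  (forall (J : seq I) (A : I -> set T'), uniq J -> (forall i, G (A i)) ->
    (P (\bigcap_(i in [set` J]) (Y i @^-1` A i)) =
     \prod_(i <- J) P (Y i @^-1` A i))%E) ->
  mutually_independent P Y.
Proof.
move=> mG IG GT mY GP.
have GM B : G B -> measurable B by rewrite mG; exact: sub_sigma_algebra.
(* [s] lists the indices already freed: arbitrary measurable sets are allowed there, only members of
   [G] elsewhere. Taking [s] equal to [J], with [setT] outside [J], gives the claim. *)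
suff H (s J : seq I) (A : I -> set T') : uniq J ->
    (forall i, measurable (A i)) -> (forall i, i \notin s -> G (A i)) ->
    (P (\bigcap_(i in [set` J]) (Y i @^-1` A i)) =
     \prod_(i <- J) P (Y i @^-1` A i))%E.
  move=> J A uJ mA; pose AJ i := if i \in J then A i else setT.
  rewrite (eq_bigcapr (G := fun i => Y i @^-1` AJ i)); last first.
    by move=> i /= iJ; rewrite /AJ iJ.
  rewrite (H J)//; first by apply: eq_big_seq => i iJ; rewrite /AJ iJ.
    by move=> i; rewrite /AJ; case: ifP.
  by move=> i iJ; rewrite /AJ (negbTE iJ).
elim: s J A => [|i s IH] J A uJ mA GA; first by apply: GP => // j; exact: GA.
(* If [i] is not in [J], the set [A i] does not occur in the intersection and may become [setT],
   which lies in [G]. *)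
have [iJ|iJ] := boolP (i \in J); last first.
  pose A' j := if j == i then setT else A j.
  have AA' j : j \in J -> A j = A' j.
    by rewrite /A'; case: eqVneq => // ->; rewrite (negbTE iJ).
  rewrite (eq_bigcapr (G := fun j => Y j @^-1` A' j)) => [|j /= /AA' ->//].
  rewrite IH//.
  - by apply: eq_big_seq => j jJ; rewrite -AA'.
  - by move=> j; rewrite /A'; case: ifP.
  - move=> j js; rewrite /A'; case: eqVneq => // ji.
    by apply: GA; rewrite in_cons negb_or ji.
set J' := rem i J.
have uJ' : uniq J' by exact: rem_uniq.
have JJ' : perm_eq J (i :: J') by exact: perm_to_rem.
have iJ' : i \notin J' by rewrite mem_rem_uniqF.
have split_cap (A1 : I -> set T') : \bigcap_(j in [set` J]) (Y j @^-1` A1 j) =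
    Y i @^-1` A1 i `&` \bigcap_(j in [set` J']) (Y j @^-1` A1 j).
  rewrite -(bigcap_setU1 (fun j => Y j @^-1` A1 j)).
  congr (\bigcap_(j in _) _).
  apply/seteqP; split=> j /=; rewrite (perm_mem JJ') in_cons.
    by case/orP => [/eqP|]; [left|right].
  by case=> [->|->]; rewrite ?eqxx ?orbT.
set C := \bigcap_(j in [set` J']) (Y j @^-1` A j).
have mC : measurable C.
  apply: fin_bigcap_measurable => // j _.
  by rewrite -[X in measurable X]setTI; exact: mY.
(* The [i]-th set is made variable: for [B] in [G] the induction hypothesis applies on [J], and
   [B = setT] gives the product formula for [C] alone. *)
pose A1 B j := if j == i then B else A j.
have A1i B : A1 B i = B by rewrite /A1 eqxx.
have A1E B j : j \in J' -> A1 B j = A j.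
  by rewrite /A1; case: eqVneq => // ->; rewrite (negbTE iJ').
have CE B : C = \bigcap_(j in [set` J']) (Y j @^-1` A1 B j).
  by apply: eq_bigcapr => j /= /A1E ->.
have A1G B j : G B -> j \notin s -> G (A1 B j).
  move=> GB js; rewrite /A1; case: eqVneq => // ji.
  by apply: GA; rewrite in_cons negb_or ji.
have mA1 B j : measurable B -> measurable (A1 B j).
  by move=> mB; rewrite /A1; case: ifP.
have PC : P C = (\prod_(j <- J') P (Y j @^-1` A j))%E.
  rewrite (CE setT) IH//; first by apply: eq_big_seq => j /A1E ->.
  - by move=> j; exact: mA1.
  - by move=> j; exact: A1G.
rewrite split_cap -/C (perm_big _ JJ')/= big_cons -PC.
apply: (@indep_event_pi _ _ G) => // B GB.
have := IH J (A1 B) uJ (fun j => mA1 B j (GM _ GB)) (fun j => A1G B j GB).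
rewrite split_cap -(CE B) (perm_big _ JJ')/= big_cons A1i => ->.
by rewrite PC; congr (_ * _)%E; apply: eq_big_seq => j /A1E ->.
Qed.

Lemma mutually_independent_comp d1 d2 (T1 : measurableType d1)
    (T2 : measurableType d2) (I : eqType) (Y : I -> T -> T1) (f : T1 -> T2) :
  measurable_fun setT f -> mutually_independent P Y ->
  mutually_independent P (fun i => f \o Y i).
Proof.
move=> mf iY J A uJ mA; apply: (iY J (fun i => f @^-1` A i)) => // i.
by rewrite -[X in measurable X]setTI; exact: mf.
Qed.

Lemma mutually_independent_inj d1 (T1 : measurableType d1) (I K : eqType)
    (Y : I -> T -> T1) (g : K -> I) :
  injective g -> mutually_independent P Y ->
  mutually_independent P (fun k => Y (g k)).
Proof.
move=> ginj iY J A uJ mA.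
(* Injectivity of [g] makes the family [A] well defined along the image of [g]; off the image [setT]
   is used. *)
have [B [mB BA]] : exists B : I -> set T1,
    (forall i, measurable (B i)) /\ forall k, B (g k) = A k.
  have /choice[B BP] (i : I) : exists B, measurable B /\
      forall k, g k = i -> B = A k.
    have [[k gk]|ng] := pselect (exists k, g k = i).
      by exists (A k); split=> // k'; rewrite -gk => /ginj ->.
    by exists setT; split=> // k gk; case: ng; exists k.
  by exists B; split=> [i|k]; [exact: (BP i).1|exact: (BP (g k)).2].
have := iY (map g J) B; rewrite map_inj_uniq// => /(_ uJ mB).
rewrite big_map => PE.
rewrite (eq_bigr (fun k => P (Y (g k) @^-1` B (g k)))); last first.
  by move=> k _; rewrite BA.
rewrite -PE; congr (P _); apply/seteqP; split=> w wA.
  by move=> i /= /mapP[k kJ ->]; rewrite /preimage/= BA; exact: wA.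
move=> k kJ; rewrite /preimage/= -BA; apply: (wA (g k)) => /=.
exact: map_f.
Qed.

End independence.

(** * Laws of tuples and product measures *)

Definition box (n : nat) (T : Type) (B : 'I_n -> set T) : set (n.-tuple T) :=
  [set t | forall i, B i (tnth t i)].

Definition measurable_boxes d (T : measurableType d) (n : nat) :
    set (set (n.-tuple T)) :=
  [set A | exists2 B : 'I_n -> set T, forall i, measurable (B i) & A = box B].

Lemma measurable_box d (T : measurableType d) (n : nat) (B : 'I_n -> set T) :
  (forall i, measurable (B i)) -> measurable (box B).
Proof.
move=> mB; rewrite (_ : box B = \bigcap_(i in [set: 'I_n])
    ((@tnth n T)^~ i @^-1` B i)); last first.
  by apply/seteqP; split => t /= h i; [move=> _|]; exact: h.
apply: fin_bigcap_measurable => // i _.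
by rewrite -[X in measurable X]setTI; exact: measurable_tnth.
Qed.

(** One-coordinate preimages generate but are not closed under intersection; boxes are, so they can
    serve as the pi-system in uniqueness arguments. *)
Lemma measurable_tupleE d (T : measurableType d) (n : nat) :
  measurable = <<s @measurable_boxes d T n >>.
Proof.
apply/seteqP; split.
  apply: smallest_sub; first exact: smallest_sigma_algebra.
  rewrite -bigcup_seq => A [i _ [B mB <-]]; apply: sub_sigma_algebra.
  exists (fun j => if j == i then B else setT); first by move=> j; case: ifP.
  rewrite setTI; apply/seteqP; split => t /=.
    by move=> Bti j; case: eqVneq => // ->.
  by move=> /(_ i); rewrite eqxx.
apply: smallest_sub; first exact: sigma_algebra_measurable.
by move=> _ [B mB ->]; exact: measurable_box.
Qed.

Lemma setI_closed_boxes d (T : measurableType d) (n : nat) :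
  setI_closed (@measurable_boxes d T n).
Proof.
move=> _ _ [A mA ->] [B mB ->]; exists (fun i => A i `&` B i).
  by move=> i; exact: measurableI.
apply/seteqP; split=> t /=; first by move=> [h1 h2] i; split.
by move=> h; split=> i; have [] := h i.
Qed.

Lemma setT_boxes d (T : measurableType d) (n : nat) :
  @measurable_boxes d T n setT.
Proof. by exists (fun=> setT) => //; apply/seteqP; split. Qed.

Lemma measurable_mktuple d d1 (T : measurableType d) (T1 : measurableType d1)
    n (Y : 'I_n -> T -> T1) : (forall i, measurable_fun setT (Y i)) ->
  measurable_fun setT (fun w => [tuple Y i w | i < n]).
Proof.
move=> mY; apply/measurable_fun_tnthP => i.
by rewrite (_ : _ \o _ = Y i)//; apply/funext => w /=; rewrite tnth_mktuple.
Qed.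

Section tuple_laws.
Context (R : realType) d (T : measurableType d) (P : probability T R).
Context d1 (T1 : measurableType d1).

Lemma mutually_independent_ord n (Y : 'I_n -> T -> T1) (B : 'I_n -> set T1) :
  mutually_independent P Y -> (forall i, measurable (B i)) ->
  (P [set w | box B [tuple Y i w | i < n]] =
   \prod_(i < n) P (Y i @^-1` B i))%E.
Proof.
move=> iY mB; have := iY (enum 'I_n) B (enum_uniq _) mB.
rewrite big_enum => <-; congr (P _); apply/seteqP; split=> w /= h i.
  by move=> _; have := h i; rewrite tnth_mktuple.
by rewrite tnth_mktuple; apply: h; rewrite /= mem_enum.
Qed.

(** It suffices to test boxes, where both sides become one product over the pairs [(k, i)]. *)
Lemma mutually_independent_mktuple (K : eqType) n (Y : K * 'I_n -> T -> T1) :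
  (forall ki, measurable_fun setT (Y ki)) ->
  mutually_independent P Y ->
  mutually_independent P (fun k w => [tuple Y (k, i) w | i < n]).
Proof.
move=> mY iY; apply: (mutually_independent_pi (@measurable_tupleE _ T1 n)).
- exact: setI_closed_boxes.
- exact: setT_boxes.
- by move=> k; exact: measurable_mktuple.
move=> J A uJ /(_ _)/cid2 - /all_sig2[B mB AB].
have iYk k : mutually_independent P (fun i => Y (k, i)).
  by apply: (mutually_independent_inj _ iY) => i j [].
rewrite [RHS](eq_bigr (fun k => \prod_(i < n) P (Y (k, i) @^-1` B k i))%E);
  last first.
  by move=> k _; rewrite AB -mutually_independent_ord.
have uJn : uniq [seq (k, i) | k <- J, i <- enum 'I_n].
  by rewrite allpairs_uniq ?enum_uniq// => -[? ?] [? ?].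
have := iY _ (fun ki => B ki.1 ki.2) uJn (fun ki => mB ki.1 ki.2).
rewrite big_allpairs => PE.
rewrite -[RHS](eq_bigr _ (fun k _ => big_enum _ _ _ _)) -PE.
congr (P _); apply/seteqP; split=> w h.
  move=> ki /= /allpairsP[[k i] /= [kJ _ ->]] /=.
  by have := h k kJ; rewrite /= AB => /(_ i); rewrite tnth_mktuple.
move=> k kJ /=; rewrite AB => i; rewrite tnth_mktuple.
apply: (h (k, i)); apply/allpairsP; exists (k, i); split=> //=.
by rewrite mem_enum.
Qed.

Lemma power_measure_box (Q : {sigma_finite_measure set T1 -> \bar R}) n
    (B : 'I_n -> set T1) : (forall i, measurable (B i)) ->
  (power_measure Q n (box B) = \prod_(i < n) Q (B i))%E.
Proof.
elim: n B => [|n IH] B mB.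
  rewrite big_ord0 /= /dirac indicE mem_set//= => -[].
  by case.
rewrite big_ord_recl -IH//= /tuple_cons_measure /pushforward.
rewrite (_ : _ @^-1` _ = B ord0 `*` box (fun i => B (lift ord0 i))).
  apply: (product_measure1E Q (power_measure Q n)) => //.
  exact: measurable_box.
apply/seteqP; split=> -[x t] /=.
  move=> h; split=> [|i]; first exact: (h ord0).
  by have := h (lift ord0 i); rewrite tnthS.
move=> [h0 h] i; case: (unliftP ord0 i) => [j ->|-> //].
by rewrite tnthS; exact: h.
Qed.

(** Both measures give a box the product of the masses of its sides. This links the canonical sample
    in [simplicial_depth] to an actual i.i.d. sample. *)
Lemma law_mktuple (Q : probability T1 R) n (Y : 'I_n -> T -> T1) :
  (forall i, measurable_fun setT (Y i)) -> mutually_independent P Y ->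
  (forall i A, measurable A -> P (Y i @^-1` A) = Q A) ->
  forall A, measurable A ->
  P [set w | A [tuple Y i w | i < n]] = power_measure Q n A.
Proof.
move=> mY iY YQ A mA.
have mt := measurable_mktuple mY.
pose m1 : {measure set (n.-tuple T1) -> \bar R} :=
  measure_function_pushforward__canonical__measure_function_Measure P mt.
apply: (@finite_measure_unique _ _ _ _ m1 (power_measure Q n)
  (@measurable_tupleE _ T1 n)) => //.
- exact: setI_closed_boxes.
- exact: setT_boxes.
- apply: (@le_lt_trans _ _ 1%E); last exact: ltry.
  by rewrite /m1/= /pushforward preimage_setT; exact: probability_le1.
move=> _ [B mB ->]; transitivity (\prod_(i < n) Q (B i))%E.
  rewrite -(eq_bigr _ (fun i _ => YQ i _ (mB i))).
  by rewrite -mutually_independent_ord.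
by rewrite -power_measure_box.
Qed.

End tuple_laws.

(** * Absolute continuity of product measures *)

Section absolute_continuity.
Context (R : realType) d (T : measurableType d).
Variables m1 m2 : {sigma_finite_measure set T -> \bar R}.
Local Open Scope ereal_scope.
Hypothesis m12 : forall A, measurable A -> m2 A = 0 -> m1 A = 0.

Lemma power_measure_dominates n (A : set (n.-tuple T)) : measurable A ->
  power_measure m2 n A = 0 -> power_measure m1 n A = 0.
Proof.
elim: n A => [//|n IH] A mA /=.
rewrite /tuple_cons_measure /pushforward.
set C := _ @^-1` A.
have mC : measurable C.
  by rewrite -[C]setTI; exact: measurable_tuple_cons.
rewrite /product_measure1.
set f1 := (X in \int[m1]_x X x); set f2 := (X in \int[m2]_x X x).
have mf1 := measurable_fun_xsection (power_measure m1 n) mC.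
have mf2 := measurable_fun_xsection (power_measure m2 n) mC.
move=> f20.
have /(@ae_eq_integral_abs _ _ _ m2 _ measurableT _ mf2)[N [mN N0 subN]] :
    \int[m2]_x `|f2 x| = 0.
  rewrite -[RHS]f20; apply: eq_integral => x _.
  by rewrite gee0_abs// /f2/= measure_ge0.
rewrite (_ : 0 = \int[m1]_x cst 0 x); last by rewrite integral0.
apply: ge0_ae_eq_integral => //.
(* [N] contains the points whose section has positive mass for the power of [m2]. It is null for
   [m2], hence for [m1], and outside it the induction hypothesis makes the section null for the
   power of [m1]. *)
exists N; split=> //; first exact: m12.
move=> x /= nf1; apply: subN => /= nf2; apply: nf1 => _.
apply: IH; first exact: measurable_xsection.
exact: nf2.
Qed.

End absolute_continuity.

(** * Barycentric description of the open simplex *)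

Lemma continuous_row_affine (R : realType) (n : nat) (a : R) (s : seq 'I_n)
    (c : 'I_n -> R) :
  continuous (fun z : 'rV[R]_n => a + \sum_(k <- s) z 0 k * c k).
Proof.
suff H : continuous (fun z : 'rV[R]_n => \sum_(k <- s) z 0 k * c k).
  move=> z; apply: (@continuousD R R^o 'rV[R]_n (cst a)); last exact: H.
  exact: cst_continuous.
elim: s => [|k s IH] z.
  rewrite (_ : (fun z0 : 'rV[R]_n => _) = cst 0); first exact: cst_continuous.
  by apply/funext => v; rewrite big_nil.
rewrite (_ : (fun z0 : 'rV[R]_n => _) =
  (fun v : 'rV[R]_n => v 0 k * c k + \sum_(j <- s) v 0 j * c j)).
  apply: (@continuousD R R^o 'rV[R]_n); last exact: IH.
  apply: (@continuousM R 'rV[R]_n (fun v => v 0 k) (cst (c k))).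
    exact: coord_continuous.
  exact: cst_continuous.
by apply/funext => v; rewrite big_cons.
Qed.

Section open_simplex.
Context (R : realType) (d : nat).
Implicit Types (x z : 'rV[R]_d) (y : 'I_d.+1 -> 'rV[R]_d) (c : 'cV[R]_d.+1).

(** Homogeneous coordinates with leading entry 1. A column [c] then acts as an affine function on
    R^d with constant term [c ord0 0], and the two conditions on barycentric weights form one linear
    system. *)
Definition homog x : 'rV[R]_d.+1 :=
  \row_j if unlift ord0 j is Some k then x 0 k else 1.

Definition homog_mx y : 'M[R]_d.+1 := \matrix_(i, j) homog (y i) 0 j.

(* The barycentric coordinates of x with respect to y, multiplied by
   (\det (homog_mx y)) ^+ 2 so that no division occurs. *)
Definition barycentric y x (i : 'I_d.+1) : R :=
  \det (homog_mx y) * (homog x *m \adj (homog_mx y)) 0 i.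

Lemma homog_mulE x c :
  (homog x *m c) 0 0 = c ord0 0 + \sum_k x 0 k * c (lift ord0 k) 0.
Proof.
rewrite mxE big_ord_recl mxE unlift_none mul1r; congr (_ + _).
by apply: eq_bigr => k _; rewrite mxE liftK.
Qed.

Lemma convex_hull_homog y x :
  convex_hull y x <->
  exists2 w : 'rV[R]_d.+1, (forall i, 0 <= w 0 i) & homog x = w *m homog_mx y.
Proof.
have homogE (w : 'rV[R]_d.+1) : (homog x = w *m homog_mx y) <->
    (\sum_i w 0 i = 1 /\ x = \sum_i w 0 i *: y i).
  split=> [E|[w1 xE]].
    split.
      move/rowP/(_ ord0) : E; rewrite !mxE unlift_none => ->.
      by apply: eq_bigr => i _; rewrite !mxE unlift_none mulr1.
    apply/rowP => k; move/rowP/(_ (lift ord0 k)) : E.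
    rewrite !mxE liftK => ->; rewrite summxE.
    by apply: eq_bigr => i _; rewrite !mxE liftK.
  apply/rowP => j; rewrite !mxE; case: (unliftP ord0 j) => [k ->|->].
    rewrite xE summxE; apply: eq_bigr => i _.
    by rewrite !mxE liftK.
  rewrite -w1; apply: eq_bigr => i _.
  by rewrite !mxE unlift_none mulr1.
split=> [[w [w0 w1 xE]]|[w w0 /homogE[w1 xE]]].
  exists (\row_i w i); first by move=> i; rewrite mxE.
  apply/homogE; split.
    by rewrite -[RHS]w1; apply: eq_bigr => i _; rewrite mxE.
  by rewrite xE; apply: eq_bigr => i _; rewrite mxE.
by exists (w 0); split.
Qed.

(** An affine function that is nonnegative at the vertices is nonnegative on the hull. If it
    vanishes at an interior point [x], a small step [t] against its gradient [v] stays in the hull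
    and gives the value [- t * |v|^2], so the gradient is zero, and then so is the constant term. *)
Lemma open_hull_affine_eq0 y x c : open_hull y x ->
  (forall i, 0 <= (homog_mx y *m c) i 0) -> (homog x *m c) 0 0 = 0 -> c = 0.
Proof.
move=> yx c0 cx0; pose v : 'rV[R]_d := \row_k c (lift ord0 k) 0.
suff ck k : c (lift ord0 k) 0 = 0.
  have c00 : c ord0 0 = 0.
    by rewrite -[RHS]cx0 homog_mulE big1 ?addr0// => k _; rewrite ck mulr0.
  apply/colP => j; rewrite [RHS]mxE.
  by case: (unliftP ord0 j) => [k ->|->].
have : (fun t : R => x - t *: v) @ 0^'+ --> x - 0 *: v.
  apply: cvg_at_right_filter.
  by apply: cvgB; [exact: cvg_cst|apply: cvgZr_tmp; exact: cvg_id].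
rewrite scale0r subr0 => /(_ _ yx) yxt.
near (0 : R)^'+ => t.
have t0 : 0 < t by near: t; exact: nbhs_right_gt.
have /convex_hull_homog[w w0 wE] : convex_hull y (x - t *: v).
  by near: t.
have : 0 <= (homog (x - t *: v) *m c) 0 0.
  by rewrite wE -mulmxA mxE sumr_ge0// => i _; rewrite mulr_ge0.
rewrite (_ : (homog (x - t *: v) *m c) 0 0 = - t * \sum_k v 0 k ^+ 2).
  rewrite mulNr oppr_ge0 pmulr_rle0// => v0.
  have /psumr_eq0P/(_ k) : \sum_k v 0 k ^+ 2 = 0.
    by apply/eqP; rewrite eq_le v0 sumr_ge0// => i _; exact: sqr_ge0.
  move=> vk0; have /eqP : v 0 k ^+ 2 = 0.
    by apply: vk0 => // i _; exact: sqr_ge0.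
  by rewrite sqrf_eq0 => /eqP; rewrite mxE.
transitivity ((homog x *m c) 0 0 - t * \sum_k v 0 k ^+ 2); last first.
  by rewrite cx0 add0r mulNr.
rewrite !homog_mulE -addrA; congr (_ + _); rewrite -mulNr.
rewrite mulr_sumr -big_split/=; apply: eq_bigr => i _.
by rewrite !mxE expr2 mulrBl mulNr mulrA.
Unshelve. all: by end_near. Qed.

Lemma open_hullP y x : open_hull y x <-> forall i, 0 < barycentric y x i.
Proof.
set M := homog_mx y; split=> [yx|yx].
  have [w w0 wE] : exists2 w : 'rV[R]_d.+1,
      (forall i, 0 <= w 0 i) & homog x = w *m M.
    by apply/convex_hull_homog; exact: interior_subset yx.
  (* A kernel vector of [M] would be a nonzero affine function vanishing at all vertices, hence at
     [x]. *)
  have M0 : \det M != 0.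
    apply/negP; rewrite -det_tr => /det0P[v v0 vM].
    have Mv : M *m v^T = 0 by rewrite -[M]trmxK -trmx_mul vM trmx0.
    move/eqP : v0; apply; apply: trmx_inj; rewrite trmx0.
    apply: (open_hull_affine_eq0 yx); first by move=> i; rewrite Mv mxE.
    by rewrite wE -mulmxA Mv mulmx0 mxE.
  (* As an affine function, [c] is the [i]-th scaled barycentric coordinate: it equals [\det M ^+ 2]
     at vertex [i] and 0 at the other vertices. Being nonzero, it cannot vanish at [x]. *)
  move=> i; pose c := \det M *: col i (\adj M).
  have Mc : M *m c = \det M ^+ 2 *: col i 1%:M.
    rewrite -scalemxAr colE mulmxA mul_mx_adj -colE expr2 -scalerA; congr (_ *: _).
    by apply/colP => j; rewrite !mxE mulr_natr.
  have bE : barycentric y x i = (homog x *m c) 0 0.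
    rewrite /barycentric -/M /c -scalemxAr colE mulmxA -colE [RHS]mxE.
    by congr (_ * _); rewrite [RHS]mxE.
  have := sqr_ge0 (\det M) => detM0.
  rewrite bE lt_neqAle; apply/andP; split; last first.
    rewrite wE -mulmxA Mc mxE sumr_ge0// => j _.
    by apply: mulr_ge0 => //; rewrite !mxE; apply: mulr_ge0 => //; exact: ler0n.
  apply/eqP => /esym xc0.
  have c0 : c = 0.
    apply: (open_hull_affine_eq0 yx) => // j.
    by rewrite Mc !mxE; apply: mulr_ge0 => //; exact: ler0n.
  move: Mc; rewrite c0 mulmx0 => /colP/(_ i); rewrite !mxE eqxx mulr1.
  by move/esym/eqP; rewrite sqrf_eq0 (negbTE M0).
have M0 : \det M != 0.
  have := yx ord0; rewrite /barycentric -/M.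
  by apply: contraTneq => ->; rewrite mul0r ltxx.
(* Divided by [\det M ^+ 2], positive coordinates are convex weights. Since the coordinates are
   affine in [z], this positivity region is a neighbourhood of [x] inside the hull. *)
have hullS : [set z | forall i, 0 < barycentric y z i] `<=` convex_hull y.
  move=> z zpos; apply/convex_hull_homog.
  exists (\row_i (barycentric y z i / \det M ^+ 2)).
    by move=> i; rewrite mxE divr_ge0 ?sqr_ge0// ltW.
  rewrite (_ : \row_i _ = (\det M)^-1 *: (homog z *m \adj M)).
    by rewrite -scalemxAl -mulmxA mul_adj_mx -/M mul_mx_scalar scalerA mulVf ?scale1r.
  apply/rowP => i; rewrite !mxE /barycentric -/M expr2 invfM.
  by rewrite mulrACA divff// mul1r mulrC mxE.
rewrite /open_hull /interior/=; apply: (filterS hullS).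
apply: (@filter_forall _ _ (fun i z => 0 < barycentric y z i) (nbhs x)) => i.
have bE z : barycentric y z i = \det M * \adj M ord0 i +
    \sum_k z 0 k * (\det M * \adj M (lift ord0 k) i).
  rewrite /barycentric -/M.
  have -> : (homog z *m \adj M) 0 i = (homog z *m col i (\adj M)) 0 0.
    by rewrite colE mulmxA -colE [RHS]mxE.
  rewrite homog_mulE mxE mulrDr mulr_sumr; congr (_ + _).
  by apply: eq_bigr => k _; rewrite mxE mulrCA.
have cbary : continuous (fun z : 'rV[R]_d => barycentric y z i).
  rewrite (funext bE); exact: (@continuous_row_affine R d _ _
    (fun k => \det M * \adj M (lift ord0 k) i)).
apply: (cbary x [set r | 0 < r]).
by apply: open_nbhs_nbhs; split; [exact: open_gt|exact: yx].
Qed.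

End open_simplex.

(** * Measurability of the event of lying in an open simplex *)

Lemma measurable_rV_coord (R : realType) n (j : 'I_n) :
  measurable_fun setT (fun v : 'rV[R]_n => v 0 j).
Proof.
apply: (measurability _ (RGenOpens.measurableE R)).
move=> _ [_ [a [b ->] <-]]; rewrite setTI; apply: sub_sigma_algebra.
by apply: open_comp => [v _|]; [exact: coord_continuous|exact: interval_open].
Qed.

Section measurable_hull.
Context (R : realType) dT (T : measurableType dT).

Lemma measurable_det n (A : T -> 'M[R]_n) :
  (forall i j, measurable_fun setT (fun w => A w i j)) ->
  measurable_fun setT (fun w => \det (A w)).
Proof.
move=> mA; apply: measurable_sum => s.
apply: measurable_funM; first exact: measurable_cst.
by apply: measurable_prod => i _; exact: mA.
Qed.

Lemma measurable_adjugate n (A : T -> 'M[R]_n) :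
  (forall i j, measurable_fun setT (fun w => A w i j)) ->
  forall i j, measurable_fun setT (fun w => (\adj (A w)) i j).
Proof.
move=> mA i j.
rewrite (_ : (fun w => _) = fun w => cofactor (A w) j i); last first.
  by apply/funext => w; rewrite mxE.
apply: measurable_funM; first exact: measurable_cst.
apply: measurable_det => k l.
rewrite (_ : (fun w => _) = fun w => A w (lift j k) (lift i l))//.
by apply/funext => w; rewrite !mxE.
Qed.

End measurable_hull.

(** By [open_hullP] the event is a finite intersection of positivity sets of polynomials in the
    entries of the vertices. *)
Lemma measurable_open_hull (R : realType) (d : nat) (x : 'rV[R]_d) :
  measurable [set t : d.+1.-tuple 'rV[R]_d | open_hull (tnth t) x].
Proof.
rewrite (_ : [set t | _] = \bigcap_(i in [set: 'I_d.+1])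
    ((fun t => barycentric (tnth t) x i) @^-1` [set r : R | 0 < r])); last first.
  by apply/seteqP; split=> t /=; rewrite open_hullP => h i; [move=> _|]; exact: h.
have mM i j : measurable_fun setT
    (fun t : d.+1.-tuple 'rV[R]_d => homog_mx (tnth t) i j).
  rewrite (_ : (fun t => _) = (fun t : d.+1.-tuple 'rV[R]_d =>
    if unlift ord0 j is Some k then tnth t i 0 k else 1)); last first.
    by apply/funext => t; rewrite !mxE.
  case: unlift => [k|]; last exact: measurable_cst.
  apply: (@measurableT_comp _ _ _ _ _ _ (fun v : 'rV[R]_d => v 0 k)).
    exact: measurable_rV_coord.
  exact: measurable_tnth.
apply: fin_bigcap_measurable => // i _.
rewrite -[X in measurable X]setTI.
suff : measurable_fun setT
    (fun t : d.+1.-tuple 'rV[R]_d => barycentric (tnth t) x i).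
  by apply=> //; apply: open_measurable; exact: open_gt.
apply: measurable_funM; first exact: measurable_det.
rewrite (_ : (fun t => _) = (fun t : d.+1.-tuple 'rV[R]_d =>
  \sum_j homog x 0 j * (\adj (homog_mx (tnth t))) j i)); last first.
  by apply/funext => t; rewrite mxE.
apply: measurable_sum => j; apply: measurable_funM; first exact: measurable_cst.
exact: measurable_adjugate.
Qed.

(** * Counting increasing tuples *)

Definition increasing_ffun (D n : nat) (j : {ffun 'I_D -> 'I_n}) : bool :=
  [forall p : 'I_D, forall q : 'I_D, (p < q)%N ==> (j p < j q)%N].

Lemma increasing_ffunP D n (j : {ffun 'I_D -> 'I_n}) :
  reflect {homo j : p q / (p < q)%N >-> (p < q)%N} (increasing_ffun j).
Proof.
apply: (iffP forallP) => [h p q pq|h p].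
  by have /forallP/(_ q)/implyP := h p; apply.
by apply/forallP => q; apply/implyP; exact: h.
Qed.

Lemma increasing_ffun_inj D n (j : {ffun 'I_D -> 'I_n}) :
  increasing_ffun j -> injective j.
Proof.
move=> /increasing_ffunP h p q jpq; apply/eqP; rewrite -val_eqE/=.
by case: ltngtP => // /h; rewrite jpq ltnn.
Qed.

Lemma sorted_increasing_ffun D n (j : {ffun 'I_D -> 'I_n}) :
  sorted ltn (map val [tuple j i | i < D]) = increasing_ffun j.
Proof.
have sz : size (map val [tuple j i | i < D]) = D by rewrite size_map size_tuple.
have nthE (p : 'I_D) : nth 0%N (map val [tuple j i | i < D]) p = j p.
  by rewrite (nth_map (j p)) ?size_tuple// -tnth_nth tnth_mktuple.
apply/idP/increasing_ffunP => [s p q pq|h].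
  by rewrite -!nthE; apply: (sorted_ltn_nth ltn_trans) => //; rewrite inE sz.
apply/(sortedP 0%N) => i; rewrite sz => iD.
rewrite (nthE (Ordinal iD)) (nthE (Ordinal (ltnW iD))).
exact: h.
Qed.

(** Listing the values turns increasing functions into strictly sorted tuples, whose number is
    known. *)
Lemma card_increasing_ffun D n :
  #|[pred j : {ffun 'I_D -> 'I_n} | increasing_ffun j]| = 'C(n, D).
Proof.
pose F (j : {ffun 'I_D -> 'I_n}) := [tuple j i | i < D].
have Finj : injective F.
  move=> j j' /(congr1 (fun t => tnth t)) E; apply/ffunP => i.
  by have := congr1 (fun f => f i) E; rewrite !tnth_mktuple.
rewrite -card_ltn_sorted_tuples -(card_imset _ Finj); apply: eq_card => t.
rewrite inE; apply/imsetP/idP => [[j] jinc ->|ts].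
  by rewrite sorted_increasing_ffun.
have tE : t = F [ffun i => tnth t i].
  by apply: eq_from_tnth => i; rewrite tnth_mktuple ffunE.
exists [ffun i => tnth t i] => //.
by rewrite inE -sorted_increasing_ffun -/(F _) -tE.
Qed.

(** An increasing function is determined by its image; deleting [s] from the image leaves a
    [d]-subset of the other [n.-1] indices. *)
Lemma card_increasing_ffun_through d n (s : 'I_n) :
  (#|[pred j : {ffun 'I_d.+1 -> 'I_n} | increasing_ffun j &
     [exists p, j p == s]]| <= 'C(n.-1, d))%N.
Proof.
pose F (j : {ffun 'I_d.+1 -> 'I_n}) := (j @: [set: 'I_d.+1] :\ s)%SET.
have := cards_draws [set~ s]%SET d; rewrite cardsC1 card_ord => <-.
rewrite -(card_in_imset (f := F)).
  apply: subset_leq_card; apply/fintype.subsetP => B /imsetP[j].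
  move=> /andP[jinc /existsP[p /eqP jps]] ->; rewrite finset.inE.
  have -> : F j \subset [set~ s]%SET by rewrite /F finset.setDE finset.subsetIr.
  have sj : s \in (j @: [set: 'I_d.+1])%SET by rewrite -jps imset_f.
  have := cardsD1 s ((j @: [set: 'I_d.+1])%SET).
  rewrite sj card_imset; last exact: increasing_ffun_inj.
  by rewrite cardsT card_ord add1n => -[dE]; rewrite /F [X in _ == X]dE eqxx.
move=> j j'; rewrite !inE => /andP[jinc /existsP[p /eqP jps]].
move=> /andP[j'inc /existsP[q /eqP jqs]] FE.
have imE : (j @: [set: 'I_d.+1])%SET = (j' @: [set: 'I_d.+1])%SET.
  have sj : s \in (j @: [set: 'I_d.+1])%SET by rewrite -jps imset_f.
  have sj' : s \in (j' @: [set: 'I_d.+1])%SET by rewrite -jqs imset_f.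
  by rewrite -(finset.setD1K sj) -(finset.setD1K sj') -/(F j) FE.
(* Equal images give equal value lists, since a strictly sorted list is determined by its
   elements. *)
have : map val [tuple j i | i < d.+1] = map val [tuple j' i | i < d.+1].
  apply: (irr_sorted_eq ltn_trans ltnn).
  - by rewrite sorted_increasing_ffun.
  - by rewrite sorted_increasing_ffun.
  move=> x; have mE (k : {ffun 'I_d.+1 -> 'I_n}) :
      (x \in map val [tuple k i | i < d.+1]) =
      (x \in map val (enum (k @: [set: 'I_d.+1])%SET)).
    apply/mapP/mapP => -[y yk ->]; exists y => //.
      by move/mapP : yk => [i _ ->]; rewrite mem_enum imset_f.
    move: yk; rewrite mem_enum => /imsetP[i _ ->].
    by apply/mapP; exists i => //; rewrite mem_enum.
  by rewrite !mE imE.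
move/(inj_map val_inj) => E; apply/ffunP => i.
have := congr1 (fun t => nth (j i) t i) E.
by rewrite -!tnth_nth !tnth_mktuple.
Qed.

Definition meet_ffun D n (j j' : {ffun 'I_D -> 'I_n}) : bool :=
  [exists p, exists q, j' q == j p].

(** Each of the [d.+1] values of [j] is taken by at most ['C(n.-1, d)] increasing functions, and
    [n * 'C(n.-1, d) = d.+1 * 'C(n, d.+1)]. *)
Lemma card_meet_ffun d n (j : {ffun 'I_d.+1 -> 'I_n}) :
  (n * #|[pred j' | increasing_ffun j' & meet_ffun j j']| <=
   d.+1 ^ 2 * 'C(n, d.+1))%N.
Proof.
have : (#|[pred j' | increasing_ffun j' & meet_ffun j j']| <=
    \sum_(p < d.+1) 'C(n.-1, d))%N.
  apply: (@leq_trans (\sum_(p < d.+1) #|[pred j' : {ffun 'I_d.+1 -> 'I_n} |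
      increasing_ffun j' & [exists q, j' q == j p]]|)); last first.
    by apply: leq_sum => p _; exact: card_increasing_ffun_through.
  rewrite -sum1_card.
  under [X in (_ <= X)%N]eq_bigr do rewrite -sum1_card big_mkcond.
  rewrite exchange_big/= [leqLHS]big_mkcond; apply: leq_sum => j' _.
  rewrite inE; case: andP => // -[j'inc /existsP[p jp]].
  by rewrite (bigD1 p)//= inE j'inc jp.
rewrite sum_nat_const card_ord => H.
apply: (leq_trans (leq_mul (leqnn n) H)).
by rewrite mulnCA mul_bin_diag mulnA.
Qed.

Lemma disjoint_ffun D n (j j' : {ffun 'I_D -> 'I_n}) :
  ~~ meet_ffun j j' -> forall p q, j p != j' q.
Proof.
move=> + p q; apply: contraNneq => jpq.
by apply/existsP; exists p; apply/existsP; exists q; rewrite jpq.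
Qed.

(** * Second moments and almost sure convergence *)

Section second_moment.
Context (R : realType) d (T : measurableType d) (P : probability T R).

Lemma integral_indic_centered (A B : set T) (l : R) :
  measurable A -> measurable B -> P A = l%:E -> P B = l%:E ->
  (\int[P]_w ((\1_A w - l) * (\1_B w - l))%:E = P (A `&` B) - (l * l)%:E)%E.
Proof.
move=> mA mB PA PB.
have intI C : measurable C -> (\1_C : T -> R) \in Lfun P 1.
  by move=> mC; apply/Lfun1_integrable; exact: integrable_indic.
have := @covarianceE _ _ _ P \1_A \1_B (intI _ mA) (intI _ mB).
have -> : (\1_A * \1_B)%R = \1_(A `&` B) :> (T -> R) by rewrite indicI.
move=> /(_ (intI _ (measurableI _ _ mA mB))).
rewrite !expectation_indic//; last exact: measurableI.
rewrite PA PB -EFinM => <-; rewrite [in RHS]unlock !expectation_indic// PA PB.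
by rewrite unlock.
Qed.

(** Expanding the square gives covariances of indicators: they vanish on pairs not related by [r]
    and are at most 1 on related pairs, which are counted on the right. *)
Lemma second_moment_le (I : finType) (D : pred I) (A : I -> set T) (l : R)
    (r : rel I) :
  (forall j, measurable (A j)) -> (forall j, D j -> P (A j) = l%:E) ->
  (forall j j', D j -> D j' -> ~~ r j j' -> P (A j `&` A j') = (l * l)%:E) ->
  (\int[P]_w ((\sum_(j | D j) (\1_(A j) w - l)) ^+ 2)%:E <=
   (\sum_(j | D j) #|[pred j' | D j' & r j j']|)%:R%:E)%E.
Proof.
move=> mA PA indepA.
have mf j : measurable_fun setT (fun w => \1_(A j) w - l : R).
  by apply: measurable_funB => //; exact: measurable_cst.
have intf j j' : P.-integrable setT
    (fun w => ((\1_(A j) w - l) * (\1_(A j') w - l))%:E).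
  apply: (@le_integrable _ _ _ _ _ measurableT _ (cst ((1 + `|l|) ^+ 2)%:E)).
  - by apply/measurable_EFinP; exact: measurable_funM.
  - move=> w _; rewrite lee_fin [leRHS]ger0_norm ?sqr_ge0// normrM expr2.
    have bd k : `|\1_(A k) w - l| <= 1 + `|l|.
      apply: (le_trans (ler_normB _ _)); rewrite lerD2r.
      by rewrite indicE; case: (_ \in _); rewrite ?normr1 ?normr0.
    exact: ler_pM.
  - exact: finite_measure_integrable_cst.
under eq_integral => w _.
  rewrite expr2 mulr_suml.
  under eq_bigr do rewrite mulr_sumr.
  rewrite pair_big_dep/= -sumEFin.
  over.
rewrite (integral_sum measurableT); last by move=> [j j']; exact: intf.
rewrite -(pair_big_dep D (fun _ => D) (fun j j' =>
  \int[P]_w ((\1_(A j) w - l) * (\1_(A j') w - l))%:E)%E)/=.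
rewrite natr_sum -sumEFin; apply: lee_sum => j Dj.
rewrite -sum1_card natr_sum -sumEFin big_mkcondr/=.
apply: lee_sum => j' Dj'; rewrite integral_indic_centered ?PA//.
case: ifPn => [_|nr]; last by rewrite indepA// -EFinB subrr.
apply: (@le_trans _ _ (P (A j `&` A j'))); last first.
  by apply: probability_le1; exact: measurableI.
by rewrite leeBlDr// leeDl// lee_fin -expr2 sqr_ge0.
Qed.

(** The expectations are summable, so the sum of the [f m] is integrable, hence almost surely
    finite, and its terms tend to 0. *)
Lemma summable_ae_cvg0 (f : nat -> T -> R) (c : R) :
  (forall m, measurable_fun setT (f m)) -> (forall m w, 0 <= f m w) ->
  (forall m, (\int[P]_w (f m w)%:E <= (c / m.+1%:R ^+ 2)%:E)%E) ->
  {ae P, forall w, f m w @[m --> \oo] --> 0}.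
Proof.
move=> mf f0 fc.
have c0 : 0 <= c.
  have := fc 0%N; rewrite expr1n divr1 -lee_fin; apply: le_trans.
  by apply: integral_ge0 => w _; rewrite lee_fin.
pose F w := (\sum_(m <oo) (f m w)%:E)%E.
have mF : measurable_fun setT F.
  apply: ge0_emeasurable_sum => [m w _ _|m _]; first by rewrite lee_fin.
  exact/measurable_EFinP.
have F0 w : (0 <= F w)%E by apply: nneseries_ge0 => m _ _; rewrite lee_fin.
have Foo : (\int[P]_w F w <= (2 * c)%:E)%E.
  rewrite integral_nneseries//; last 2 first.
    by move=> m; exact/measurable_EFinP.
    by move=> m w _; rewrite lee_fin.
  apply: lime_le.
    apply: is_cvg_ereal_nneg_natsum => m _.
    by apply: integral_ge0 => w _; rewrite lee_fin.
  apply: nearW => n.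
  (* This rests on the bound [2 - 1/(k+1)] for the sum of the first [k+1] inverse squares; the slack
     gained at each induction step is [1/(x (x+1)^2)] with [x = k+1]. *)
  have H k : (\sum_(0 <= m < k.+1) \int[P]_w (f m w)%:E <=
      ((2 - k.+1%:R^-1) * c)%:E)%E.
    elim: k => [|k IH].
      rewrite big_nat1; apply: (le_trans (fc 0%N)); rewrite lee_fin.
      by rewrite expr1n divr1 invr1 (_ : 2 - 1 = 1) ?mul1r//; ring.
    rewrite big_nat_recr//=; apply: (le_trans (leeD IH (fc k.+1))).
    rewrite -EFinD lee_fin [c / _]mulrC -mulrDl ler_wpM2r//.
    set x : R := k.+1%:R; have x0 : 0 < x by rewrite ltr0n.
    rewrite -[k.+2]addn1 natrD -/x.
    rewrite -addrA lerD2l -subr_ge0.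
    rewrite (_ : _ - _ = (x * (x + 1) ^+ 2)^-1).
      by rewrite invr_ge0 mulr_ge0 ?sqr_ge0 ?ltW.
    by field; rewrite !gt_eqF// ltr_wpDr.
  case: n => [|n]; first by rewrite big_geq// lee_fin mulr_ge0.
  apply: (le_trans (H n)); rewrite lee_fin ler_wpM2r// gerBl.
  by rewrite invr_ge0.
have intF : P.-integrable setT F.
  apply/integrableP; split=> //.
  under eq_integral do rewrite gee0_abs//.
  by apply: (le_lt_trans Foo); exact: ltry.
have := integrable_ae measurableT intF.
apply: filterS => w /(_ I) Fw.
apply: cvg_series_cvg_0.
have Fw' : (F w < +oo)%E by rewrite -ge0_fin_numE.
apply: nondecreasing_is_cvgn.
  by apply/nondecreasing_seqP => n; rewrite !seriesEnat/= big_nat_recr//= lerDl.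
exists (fine (F w)) => _ [n _ <-]; rewrite seriesEnat/=.
rewrite -lee_fin fineK// -sumEFin.
by apply: nneseries_lim_ge => m _ _; rewrite lee_fin.
Qed.

End second_moment.

(** * Interpolation between squares *)

Section interpolation.
Context (R : realType).

Lemma cvg_ffact_ratio (D : nat) :
  ((m.+2 ^ 2) ^_ D)%:R / ((m.+1 ^ 2) ^_ D)%:R @[m --> \oo] --> (1 : R).
Proof.
elim: D => [|i IH].
  by under eq_cvg do rewrite !ffactn0 divr1; exact: cvg_cst.
suff H : (m.+2 ^ 2 - i)%:R / (m.+1 ^ 2 - i)%:R @[m --> \oo] --> (1 : R).
  have E m : ((m.+2 ^ 2) ^_ i.+1)%:R / ((m.+1 ^ 2) ^_ i.+1)%:R =
      ((m.+2 ^ 2) ^_ i)%:R / ((m.+1 ^ 2) ^_ i)%:R *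
      ((m.+2 ^ 2 - i)%:R / (m.+1 ^ 2 - i)%:R) :> R.
    by rewrite !ffactnSr !natrM invfM mulrACA.
  by rewrite (funext E); have := cvgM IH H; rewrite mulr1; apply.
(* Once [i < m] no subtraction is truncated. The excess over 1 is [(2m+3) / ((m+1)^2 - i)], and the
   constant 5 works because [(2m+3)(m+1) <= 5((m+1)^2 - i)]. *)
apply: (@squeeze_cvgr _ _ _ _ (cst 1) (fun m => 1 + 5 * harmonic m)).
- near=> m.
  have im : (i < m)%N by near: m; exact: nbhs_infty_gt.
  have im1 : (i <= m.+1 ^ 2)%N by nia.
  have im2 : (i <= m.+2 ^ 2)%N by nia.
  rewrite /cst /harmonic/= !natrB// !natrX.
  have m1 : (1 : R) <= m%:R by rewrite ler1n; exact: leq_ltn_trans im.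
  have imr : (i%:R : R) <= m%:R by rewrite ler_nat ltnW.
  rewrite -[m.+2]addn1 -[m.+1]addn1 !natrD.
  set x : R := m%:R in m1 imr *; set y : R := i%:R in imr *.
  have den : 0 < (x + 1) ^+ 2 - y by nra.
  rewrite ler_pdivlMr// mul1r; apply/andP; split; first by nra.
  rewrite ler_pdivrMr// -subr_ge0.
  have x1 : 0 < x + 1 by lra.
  rewrite (_ : _ - _ = (5 * ((x + 1) ^+ 2 - y) - (2 * x + 3) * (x + 1)) / (x + 1)).
    by apply: divr_ge0; [nra|lra].
  by field; rewrite gt_eqF.
- exact: cvg_cst.
- have := cvgD (cvg_cst (1 : R)) (cvgM (cvg_cst (5 : R)) (@cvg_harmonic R)).
  by rewrite mulr0 addr0; apply.
Unshelve. all: by end_near. Qed.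

Lemma cvg_bin_ratio (D : nat) :
  'C(m.+2 ^ 2, D)%:R / 'C(m.+1 ^ 2, D)%:R @[m --> \oo] --> (1 : R).
Proof.
rewrite (_ : (fun m => _) = fun m =>
  ((m.+2 ^ 2) ^_ D)%:R / ((m.+1 ^ 2) ^_ D)%:R); first exact: cvg_ffact_ratio.
apply/funext => m; rewrite -!bin_ffact !natrM invfM mulrACA divff ?mulr1//.
Qed.

Lemma nat_between_squares (n : nat) :
  (0 < n)%N -> exists m, (m.+1 ^ 2 <= n < m.+2 ^ 2)%N.
Proof.
elim: n => [//|[|n] IH _]; first by exists 0%N.
have [m /andP[m1 m2]] := IH isT.
have [nm|nm] := ltnP n.+2 (m.+2 ^ 2); first by exists m; rewrite nm andbT leqW.
by exists m.+1; rewrite nm/=; nia.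
Qed.

(** Between consecutive squares, monotonicity of numerator and denominator bounds the quotient by
    mixed quotients at the two squares; these have the same limit by [cvg_bin_ratio]. *)
Lemma cvg_bin_interpolate (D : nat) (Z : nat -> R) (l : R) :
  nondecreasing_seq Z -> (forall n, 0 <= Z n) ->
  Z (m.+1 ^ 2)%N / 'C(m.+1 ^ 2, D)%:R @[m --> \oo] --> l ->
  Z n / 'C(n, D)%:R @[n --> \oo] --> l.
Proof.
move=> ndZ Z0 Zl.
have /choice[s sP] (n : nat) : exists m, (0 < n -> m.+1 ^ 2 <= n < m.+2 ^ 2)%N.
  case: n => [|n]; first by exists 0%N.
  by have [m] := nat_between_squares (ltn0Sn n); exists m.
have soo : s n @[n --> \oo] --> \oo.
  apply/cvgnyPge => A; near=> n.
  (* If [s n < A], then [n < (s n).+2 ^ 2 < A.+2 ^ 2], which contradicts this bound. *)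
  have An : (A.+2 ^ 2 <= n)%N by near: n; exact: nbhs_infty_ge.
  have /andP[_ nn] : ((s n).+1 ^ 2 <= n < (s n).+2 ^ 2)%N.
    by apply: sP; apply: leq_trans An; rewrite expn_gt0.
  by rewrite leqNgt; apply/negP => sA; nia.
pose lo m : R := Z (m.+1 ^ 2)%N / 'C(m.+2 ^ 2, D)%:R.
pose up m : R := Z (m.+2 ^ 2)%N / 'C(m.+1 ^ 2, D)%:R.
have bin_neq0 k m : (D <= m.+1)%N -> 'C((m + k.+1) ^ 2, D)%:R != 0 :> R.
  by move=> Dm; rewrite pnatr_eq0 -lt0n bin_gt0; nia.
have lol : lo @ \oo --> l.
  rewrite -[l]mulr1 -[1 in X in _ --> X]invr1.
  apply: cvg_trans (near_eq_cvg _) (cvgM Zl (cvgV (oner_neq0 _) (cvg_bin_ratio D))).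
  near=> m.
  have Dm : (D <= m.+1)%N by apply: leqW; near: m; exact: nbhs_infty_ge.
  by rewrite /lo/= invfM invrK mulrA mulrAC mulrVK// ?mulrAC// unitfE -(addn1 m) bin_neq0.
have upl : up @ \oo --> l.
  rewrite -[l]mulr1.
  have Zl1 : Z (m.+2 ^ 2)%N / 'C(m.+2 ^ 2, D)%:R @[m --> \oo] --> l.
    by move: Zl; rewrite -(cvg_shiftS (fun m => Z (m.+1 ^ 2)%N / 'C(m.+1 ^ 2, D)%:R)).
  apply: cvg_trans (near_eq_cvg _) (cvgM Zl1 (cvg_bin_ratio D)).
  near=> m.
  have Dm : (D <= m.+1)%N by apply: leqW; near: m; exact: nbhs_infty_ge.
  by rewrite /up/= mulrA mulfVK// -(addn2 m) bin_neq0.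
apply: (@squeeze_cvgr _ _ _ _ (lo \o s) (up \o s)).
- near=> n.
  have n0 : (0 < n)%N by near: n; exact: nbhs_infty_gt.
  have Dn : (D <= n)%N by near: n; exact: nbhs_infty_ge.
  have Ds : (D <= s n)%N by near: n; move/cvgnyPge : soo; exact.
  have /andP[sn ns] := sP n n0.
  rewrite /lo /up/=; apply/andP; split.
    apply: ler_pM; rewrite ?invr_ge0//; first exact: ndZ.
    rewrite lef_pV2 ?posrE ?ltr0n ?bin_gt0//; last by nia.
    by rewrite ler_nat leq_bin2l// ltnW.
  apply: ler_pM; rewrite ?invr_ge0//; first by apply: ndZ; exact: ltnW.
  rewrite lef_pV2 ?posrE ?ltr0n ?bin_gt0//; last by nia.
  by rewrite ler_nat leq_bin2l.
- exact: cvg_comp soo lol.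
- exact: cvg_comp soo upl.
Unshelve. all: by end_near. Qed.

End interpolation.

(** * A strong law for U-statistics *)

Lemma setI_bool_bigcap (T : Type) (F : bool -> set T) :
  \bigcap_(b in [set` [:: true; false]]) F b = F true `&` F false.
Proof.
apply/seteqP; split=> w.
  by move=> h; split; apply: h; rewrite /= !inE.
by move=> [h1 h2] [] _.
Qed.

Section u_statistics.
Context (R : realType) d0 (T : measurableType d0) (P : probability T R).
Context d1 (T1 : measurableType d1) (Q : probability T1 R) (d : nat).
Variables (Y : nat -> T -> T1) (S : set (d.+1.-tuple T1)).
Hypothesis mY : forall i, measurable_fun setT (Y i).
Hypothesis indepY : mutually_independent P Y.
Hypothesis lawY : forall i A, measurable A -> P (Y i @^-1` A) = Q A.
Hypothesis mS : measurable S.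

Definition tuple_event (j : 'I_d.+1 -> nat) : set T :=
  [set w | S [tuple Y (j i) w | i < d.+1]].

(** An unnormalised U-statistic of order [d.+1] whose kernel is the indicator of [S]; [Z_] is an
    instance. *)
Definition u_sum (n : nat) (w : T) : R :=
  \sum_(j : {ffun 'I_d.+1 -> 'I_n} | increasing_ffun j)
    \1_(tuple_event (fun i => j i)) w.

Let l : R := fine (power_measure Q d.+1 S).

Lemma measurable_tuple_event j : measurable (tuple_event j).
Proof.
rewrite -[X in measurable X]setTI.
exact: (measurable_mktuple (fun i : 'I_d.+1 => mY (j i))).
Qed.

Lemma prob_tuple_event j : injective j -> P (tuple_event j) = l%:E.
Proof.
move=> jinj; have E : P (tuple_event j) = power_measure Q d.+1 S.
  apply: (@law_mktuple _ _ _ P _ _ Q d.+1 (fun i => Y (j i))) => //.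
  - exact: (mutually_independent_inj jinj).
  - by move=> i A; exact: lawY.
by rewrite /l -E fineK// fin_num_measure//; exact: measurable_tuple_event.
Qed.

Lemma prob_tuple_eventI j j' : injective j -> injective j' ->
  (forall p q, j p != j' q) ->
  P (tuple_event j `&` tuple_event j') = (l * l)%:E.
Proof.
move=> jinj j'inj jj'.
(* The two disjoint index tuples merge into one injective family indexed by pairs; its two blocks
   are then independent by [mutually_independent_mktuple]. *)
pose g (bi : bool * 'I_d.+1) := if bi.1 then j bi.2 else j' bi.2.
have ginj : injective g.
  move=> [[] p] [[] q]; rewrite /g/=.
  - by move/jinj ->.
  - by move/eqP; rewrite (negbTE (jj' p q)).
  - by move/esym/eqP; rewrite (negbTE (jj' q p)).
  - by move/j'inj ->.
have := mutually_independent_mktuple (fun ki => mY (g ki))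
  (mutually_independent_inj ginj indepY).
move=> /(_ [:: true; false] (fun=> S) isT (fun=> mS)).
rewrite setI_bool_bigcap big_cons big_seq1 => ->.
rewrite EFinM; congr (_ * _)%E; first exact: (prob_tuple_event jinj).
exact: (prob_tuple_event j'inj).
Qed.

Lemma u_sum_ge0 n w : 0 <= u_sum n w.
Proof. by apply: sumr_ge0 => j _; rewrite indicE. Qed.

(** Widening the codomain embeds the increasing functions into ['I_m] among those into ['I_n], and
    the remaining terms are nonnegative. *)
Lemma u_sum_nondecreasing w : nondecreasing_seq (u_sum^~ w).
Proof.
move=> m n mn; rewrite /u_sum.
pose W (j : {ffun 'I_d.+1 -> 'I_m}) := [ffun i => widen_ord mn (j i)].
have Winj : injective W.
  move=> j j' /ffunP E; apply/ffunP => i; apply/val_inj.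
  by have := congr1 val (E i); rewrite !ffunE.
pose A := finset [pred j : {ffun 'I_d.+1 -> 'I_m} | increasing_ffun j].
pose F (k : {ffun 'I_d.+1 -> 'I_n}) : R := \1_(tuple_event (fun i => k i)) w.
have -> : \sum_(j : {ffun 'I_d.+1 -> 'I_m} | increasing_ffun j)
      \1_(tuple_event (fun i => j i)) w = \sum_(k in (W @: A)%SET) F k.
  rewrite big_imset/=; last by move=> j j' _ _; exact: Winj.
  apply: eq_big => [j|j _]; first by rewrite finset.inE.
  congr (\1_(tuple_event _) w).
  by apply/funext => i; rewrite ffunE.
rewrite [leRHS](bigID (mem (W @: A)%SET))/=.
rewrite -[leLHS]addr0 lerD//; last by apply: sumr_ge0 => j _; rewrite indicE.
rewrite le_eqVlt; apply/orP; left; apply/eqP; apply: eq_bigl => k.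
apply/idP/andP => [kW|[]//]; split=> //.
move/imsetP : kW => [j jinc ->]; apply/increasing_ffunP => p q pq.
rewrite !ffunE/=; move: jinc; rewrite finset.inE => /increasing_ffunP; exact.
Qed.

Lemma measurable_u_sum n : measurable_fun setT (u_sum n).
Proof.
rewrite (_ : u_sum n = fun w =>
  \sum_(j <- seq.filter (@increasing_ffun d.+1 n) (index_enum _))
    \1_(tuple_event (fun i => j i)) w); last first.
  by apply/funext => w; rewrite big_filter.
apply: measurable_sum => j; apply: measurable_indic.
exact: measurable_tuple_event.
Qed.

Lemma u_sum_second_moment n : (d < n)%N ->
  (\int[P]_w ((u_sum n w / 'C(n, d.+1)%:R - l) ^+ 2)%:E <=
   (d.+1%:R ^+ 2 / n%:R)%:E)%E.
Proof.
move=> dn; set N : R := 'C(n, d.+1)%:R.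
have N0 : 0 < N by rewrite ltr0n bin_gt0.
have NE : N = \sum_(j : {ffun 'I_d.+1 -> 'I_n} | increasing_ffun j) 1.
  by rewrite sumr_const card_increasing_ffun.
under eq_integral => w _.
  (* Since [N] counts the summands, [l] can be distributed over them, so that every term is
     centred. *)
  rewrite (_ : u_sum n w / N - l = N^-1 *
    \sum_(j : {ffun 'I_d.+1 -> 'I_n} | increasing_ffun j)
      (\1_(tuple_event (fun i => j i)) w - l)); last first.
    rewrite sumrB mulrBr mulrC; congr (_ - _).
    by rewrite -[l in RHS]mul1r -mulr_suml -NE mulrA mulVf ?mul1r// gt_eqF.
  rewrite exprMn EFinM.
  over.
have N20 : 0 <= N^-1 ^+ 2 by exact: sqr_ge0.
rewrite ge0_integralZl//; last 2 first.
- apply/measurable_EFinP; apply: measurable_funX.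
  rewrite (_ : (fun w => _) = fun w => u_sum n w - N * l).
    by apply: measurable_funB; [exact: measurable_u_sum|exact: measurable_cst].
  apply/funext => w; rewrite sumrB NE mulr_suml.
  by under [in RHS]eq_bigr do rewrite mul1r.
- by move=> w _; rewrite lee_fin sqr_ge0.
have njinj (j : {ffun 'I_d.+1 -> 'I_n}) :
    increasing_ffun j -> injective (fun i => j i : nat).
  by move=> jinc p q /val_inj; exact: increasing_ffun_inj.
have := @second_moment_le _ _ _ P {ffun 'I_d.+1 -> 'I_n} (@increasing_ffun _ _)
  (fun j => tuple_event (fun i => j i)) l (@meet_ffun _ _).
move=> /(_ (fun j => measurable_tuple_event _)).
move=> /(_ (fun j jinc => prob_tuple_event (njinj _ jinc))).
have dis (j j' : {ffun 'I_d.+1 -> 'I_n}) :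
    increasing_ffun j -> increasing_ffun j' -> ~~ meet_ffun j j' ->
    P (tuple_event (fun i => j i) `&` tuple_event (fun i => j' i)) = (l * l)%:E.
  move=> jinc j'inc /disjoint_ffun dj.
  apply: (prob_tuple_eventI (njinj j jinc) (njinj j' j'inc)).
  by move=> p q; rewrite (inj_eq val_inj).
move=> /(_ dis) H.
have N2 : (0 <= (N^-1 ^+ 2)%:E)%E by rewrite lee_fin.
apply: (le_trans (lee_wpmul2l N2 H)); rewrite -EFinM lee_fin.
have n0 : 0 < n%:R :> R by rewrite ltr0n (leq_ltn_trans _ dn).
rewrite ler_pdivlMr// exprVn -mulrA ler_pdivrMl ?exprn_gt0//.
rewrite -natrX -natrX -!natrM ler_nat mulnC big_distrr/=.
(* Each of the [N] outer indices contributes at most [(d+1)^2 * N] after multiplication by [n]; the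
   resulting [N^2] cancels the normalisation. *)
apply: (@leq_trans (\sum_(j : {ffun 'I_d.+1 -> 'I_n} | increasing_ffun j)
    d.+1 ^ 2 * 'C(n, d.+1))); first by apply: leq_sum => j _; exact: card_meet_ffun.

by rewrite sum_nat_const card_increasing_ffun -(mulnn 'C(n, d.+1)) mulnCA mulnC.
Qed.

Theorem u_sum_ae_cvg :
  {ae P, forall w, u_sum n w / 'C(n, d.+1)%:R @[n --> \oo] --> l}.
Proof.
(* The shift by [d] makes every square exceed [d], as the second-moment bound requires; it is undone
   by [cvg_shiftn]. *)
pose f m w := (u_sum ((m + d).+1 ^ 2) w / 'C((m + d).+1 ^ 2, d.+1)%:R - l) ^+ 2.
have mf m : measurable_fun setT (f m).
  apply: measurable_funX; apply: measurable_funB; last exact: measurable_cst.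
  by apply: measurable_funM; [exact: measurable_u_sum|exact: measurable_cst].
have : {ae P, forall w, f m w @[m --> \oo] --> 0}.
  apply: (@summable_ae_cvg0 _ _ _ _ _ (d.+1%:R ^+ 2)) => // [m w|m].
    exact: sqr_ge0.
  apply: le_trans (u_sum_second_moment _) _; first by nia.
  rewrite lee_fin ler_wpM2l ?sqr_ge0// natrX.
  rewrite lef_pV2 ?posrE ?exprn_gt0 ?ltr0n//.
  by rewrite lerXn2r ?nnegrE ?ler0n// ler_nat ltnS leq_addr.
apply: filterS => w fw.
apply: cvg_bin_interpolate; first exact: u_sum_nondecreasing.
  by move=> n; exact: u_sum_ge0.
rewrite -(cvg_shiftn d).
apply/subr_cvg0/norm_cvg0P.
have : Num.sqrt (f m w) @[m --> \oo] --> (0 : R).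
  rewrite -[X in _ --> X](@sqrtr0 R).
  by apply: continuous_cvg => //; exact: sqrt_continuous.
by rewrite /f; under eq_cvg do rewrite sqrtr_sqr.
Qed.

End u_statistics.

(** * Half-spaces and independent coordinates *)

Section coordinates.
Context (R : realType) d0 (T : measurableType d0) (P : probability T R).

(** Pairs are grouped by first index: independence of the [X i] separates the groups, and
    independence of the [c k \o X i] factors each group. *)
Lemma mutually_independent_pair d1 d2 (T1 : measurableType d1)
    (T2 : measurableType d2) (I K : eqType) (X : I -> T -> T1)
    (c : K -> T1 -> T2) :
  (forall k, measurable_fun setT (c k)) ->
  mutually_independent P X ->
  (forall i, mutually_independent P (fun k => c k \o X i)) ->
  mutually_independent P (fun ik : I * K => c ik.2 \o X ik.1).
Proof.
move=> mc iX icX J A uJ mA.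
(* [S] lists the distinct first indices in [J], and [L i] the second indices paired with [i]. *)
pose S := undup (map fst J).
pose L i := [seq x.2 | x <- J & x.1 == i].
have LP i k : k \in L i = ((i, k) \in J).
  apply/mapP/idP => [[[i' k']]|ikJ]; last by exists (i, k); rewrite ?mem_filter ?eqxx.
  by rewrite mem_filter/= => /andP[/eqP -> ikJ ->].
have uL i : uniq (L i).
  rewrite map_inj_in_uniq ?filter_uniq// => -[i1 k1] [i2 k2].
  by rewrite !mem_filter/= => /andP[/eqP -> _] /andP[/eqP -> _] ->.
pose E i := \bigcap_(k in [set` L i]) (c k @^-1` A (i, k)).
have mE i : measurable (E i).
  apply: fin_bigcap_measurable => // k _.
  by rewrite -[X in measurable X]setTI; exact: mc.
have -> : \bigcap_(ik in [set` J]) ((c ik.2 \o X ik.1) @^-1` A ik) =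
    \bigcap_(i in [set` S]) (X i @^-1` E i).
  apply/seteqP; split=> w h.
    by move=> i _ k /=; rewrite LP => ikJ; exact: (h (i, k)).
  move=> [i k] /= ikJ; apply: (h i); last by rewrite /= LP.
  by rewrite /= mem_undup; apply/mapP; exists (i, k).
rewrite iX//; last exact: undup_uniq.
transitivity (\prod_(i <- S) \prod_(x <- J | i == x.1)
    P ((c x.2 \o X x.1) @^-1` A x))%E.
  apply: eq_bigr => i _.
  rewrite -[RHS](big_filter _ (fun x => i == x.1)).
  rewrite (_ : X i @^-1` E i =
      \bigcap_(k in [set` L i]) ((c k \o X i) @^-1` A (i, k))).
    rewrite (icX i _ (fun k => A (i, k)))// big_map.
    rewrite (@eq_filter _ _ (fun x => x.1 == i)) => [|x]; last by rewrite eq_sym.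
    by apply: eq_big_seq => -[i' k]; rewrite mem_filter/= => /andP[/eqP -> _].
  by apply/seteqP; split.
rewrite (exchange_big_dep xpredT)//=; apply: eq_big_seq => x xJ.
rewrite -big_filter (@filter_pred1_uniq _ S x.1) ?undup_uniq ?big_seq1//.
by rewrite mem_undup map_f.
Qed.

End coordinates.

(** * Points on one side of a hyperplane, and vanishing infima *)

(** The sign of [s] selects a side of the hyperplane where coordinate [j] equals that of [x]. A
    convex combination equal to [x] would average strictly positive quantities to 0. *)
Lemma halfspace_notin_open_hull (R : realType) (d : nat) (I : finType)
    (y : I -> 'rV[R]_d) (x : 'rV[R]_d) (s : R) (j : 'I_d) :
  (forall i, 0 < s * (y i 0 j - x 0 j)) -> ~ open_hull y x.
Proof.
move=> ypos /interior_subset[w [w0 w1 xE]].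
have : \sum_i w i * (s * (y i 0 j - x 0 j)) = 0.
  transitivity (s * (\sum_i w i * y i 0 j - (\sum_i w i) * x 0 j)).
    rewrite mulr_suml -sumrB mulr_sumr; apply: eq_bigr => i _.
    by rewrite mulrBr mulrBr mulrBr mulrCA (mulrCA (w i) s).
  rewrite w1 mul1r [in X in _ - X]xE summxE.
  under [X in _ - X]eq_bigr do rewrite mxE.
  by rewrite subrr mulr0.
have wy0 i : 0 <= w i * (s * (y i 0 j - x 0 j)) by rewrite mulr_ge0// ltW.
move/psumr_eq0P => /(_ (fun i _ => wy0 i)) wz.
have wi i : w i = 0.
  have /eqP := wz i isT; rewrite mulf_eq0 => /orP[/eqP//|].
  by rewrite gt_eqF.
by move: w1; rewrite big1// => /esym/eqP; rewrite oner_eq0.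
Qed.

Lemma inf_range_eq0 (R : realType) (f : nat -> R) (k : nat) :
  (forall i, 0 <= f i) -> f k = 0 -> inf (range f) = 0.
Proof.
move=> f0 fk0; apply/eqP; rewrite eq_le; apply/andP; split.
  by rewrite -fk0; apply: ge_inf; [exists 0 => _ [i _ <-]|exists k].
by apply: lb_le_inf; [exists (f k), k|move=> _ [i _ <-]].
Qed.

(** The full intersection lies in each finite one, so its probability is at most [r ^+ K] for every
    [K]. *)
Lemma prob_bigcap_geometric_eq0 (R : realType) d0 (T : measurableType d0)
    (P : probability T R) (F : nat -> set T) (r : R) :
  (forall k, measurable (F k)) -> 0 <= r < 1 ->
  (forall K, P (\bigcap_(k in [set` iota 0 K]) F k) = (r ^+ K)%:E) ->
  P (\bigcap_k F k) = 0%E.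
Proof.
move=> mF /andP[r0 r1] PF.
have mFF : measurable (\bigcap_k F k) by exact: bigcapT_measurable.
have PFF : (fine (P (\bigcap_k F k)))%:E = P (\bigcap_k F k).
  by rewrite fineK// fin_num_measure.
rewrite -PFF; congr EFin; apply/eqP; rewrite eq_le fine_ge0// andbT.
have rK : r ^+ K @[K --> \oo] --> 0 by apply: cvg_expr; rewrite ger0_norm.
rewrite -(cvg_lim _ rK)//; apply: limr_ge; first by apply/cvg_ex; exists 0.
apply: nearW => K; rewrite -lee_fin PFF -PF.
apply: le_measure; rewrite ?inE//.
  exact: fin_bigcap_measurable.
by move=> w h k _; exact: h.
Qed.

(** * The block model *)

Section blocks.
Context (R : realType) (d : nat).
Context (disp0 : measure_display) (Omega0 : measurableType disp0).
Context (P0 : probability Omega0 R) (eta : nat -> {RV P0 >-> R}).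
Hypothesis eta_indep : mutually_independent P0 (fun i => eta i : Omega0 -> R).
Hypothesis eta_id : identically_distributed P0 (fun i => eta i : Omega0 -> R).
Hypothesis eta_density : has_density P0 (eta 0%N).
Context (X : {RV P0 >-> Rinf R}).
Hypothesis X_eta : forall w i, X w i = eta i.+1 w.

(* The library's measurable structure on R and the one on measurableTypeR R,
   which carries the Lebesgue measure, have the same measurable sets but
   different displays. *)
Let etaR (i : nat) : Omega0 -> measurableTypeR R := eta i.

Let measurable_etaR i : measurable_fun setT (etaR i).
Proof. exact: (measurable_funPT (eta i)). Qed.

Let eta0 : {mfun Omega0 >-> measurableTypeR R} :=
  HB.pack_for {mfun Omega0 >-> measurableTypeR R} (etaR 0)
    (isMeasurableFun.Build _ _ _ _ _ (measurable_etaR 0)).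

Let law : probability (measurableTypeR R) R := distribution P0 eta0.

(** This is the map through which [lebesgue_rV] is an image measure, so domination between product
    measures carries over to R^d. *)
Definition row_of_tuple (t : d.-tuple (measurableTypeR R)) : 'rV[R]_d :=
  \row_(i < d) tnth t i.

Lemma measurable_row_of_tuple : measurable_fun setT row_of_tuple.
Proof.
apply: measurable_row => i.
rewrite (_ : (fun _ => _) = (@tnth d (measurableTypeR R))^~ i).
  exact: measurable_tnth.
by apply/funext => t; rewrite mxE.
Qed.

(** The successor is there because [eta 0] is the generic variable and coordinate [i] of [X] is
    [eta i.+1]. *)
Definition block_index (ki : nat * 'I_d) : nat := (ki.1 * d + ki.2).+1.

Lemma block_index_inj : injective block_index.
Proof.
move=> [k i] [k' i'] [] /= E.
have : edivn (k * d + i) d = edivn (k' * d + i') d by rewrite E.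
by rewrite !edivn_eq// => -[-> /val_inj ->].
Qed.

Lemma eta_block_indep : mutually_independent P0
  (fun ki => etaR (block_index ki)).
Proof. exact: (mutually_independent_inj block_index_inj eta_indep). Qed.

Lemma theta_blockE k : theta R d k \o X =
  row_of_tuple \o (fun w => [tuple etaR (block_index (k, i)) w | i < d]).
Proof.
apply/funext => w; apply/rowP => i.
by rewrite [LHS]mxE [RHS]mxE tnth_mktuple X_eta.
Qed.

Lemma measurable_theta_block k : measurable_fun setT (theta R d k \o X).
Proof. exact: measurableT_comp. Qed.

Lemma theta_block_indep :
  mutually_independent P0 (fun k => theta R d k \o X).
Proof.
rewrite (_ : (fun k => _) = (fun k => row_of_tuple \o
    (fun w => [tuple etaR (block_index (k, i)) w | i < d]))); last first.
  by apply/funext => k; exact: theta_blockE.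
apply: (mutually_independent_comp measurable_row_of_tuple).
by apply: (mutually_independent_mktuple _ eta_block_indep) => ki.
Qed.

(** The right side is free of [k], so this also shows that the blocks are identically
    distributed. *)
Lemma theta_block_law k A : measurable A ->
  P0 ((theta R d k \o X) @^-1` A) =
  power_measure law d (row_of_tuple @^-1` A).
Proof.
move=> mA; rewrite theta_blockE.
apply: (@law_mktuple _ _ _ P0 _ _ law d
  (fun i => etaR (block_index (k, i)))) => //.
- apply: (mutually_independent_inj _ eta_block_indep (g := fun i => (k, i))).
  by move=> i j [].
- by move=> i B mB; exact: (eta_id _ _ mB).
- by rewrite -[X in measurable X]setTI; exact: measurable_row_of_tuple.
Qed.

Lemma density_dominates (A : set (measurableTypeR R)) : measurable A ->
  lebesgue_measure A = 0%E -> law A = 0%E.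
Proof.
move=> mA A0; have [f [mf f0 fE]] := eta_density.
have -> : law A = P0 (eta 0%N @^-1` A) by [].
rewrite fE//; apply: null_set_integral => //.
by apply/measurable_EFinP; exact: measurable_funTS.
Qed.

Lemma theta_block_dominated :
  distribution (distribution P0 X) (theta R d 0) `<< lebesgue_rV R d.
Proof.
move=> N N0 A mA AN.
have -> : distribution (distribution P0 X) (theta R d 0) A =
  P0 ((theta R d 0 \o X) @^-1` A) by [].
rewrite theta_block_law//.
have mrA : measurable (row_of_tuple @^-1` A).
  by rewrite -[X in measurable X]setTI; exact: measurable_row_of_tuple.
exact: (@power_measure_dominates R _ (measurableTypeR R) law lebesgue_measure
  density_dominates d (row_of_tuple @^-1` A) mrA (N0 A mA AN)).
Qed.

Let side (s c : R) : set R := [set x | 0 < s * (x - c)].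

Let measurable_side s c : measurable (side s c).
Proof.
rewrite (_ : side s c = (fun x => s * (x - c)) @^-1` [set r | 0 < r])//.
rewrite -[X in measurable X]setTI.
suff : measurable_fun setT (fun x : R => s * (x - c)).
  by apply=> //; apply: open_measurable; exact: open_gt.
apply: measurable_funM; first exact: measurable_cst.
by apply: measurable_funB => //; exact: measurable_cst.
Qed.

(** The two open half-lines at [c] and the point [c] cover the line, and the point has mass 0
    because [eta 0] has a density. *)
Lemma density_side (c : R) : exists s, (0 < P0 (eta 0%N @^-1` side s c))%E.
Proof.
have m_eta A : measurable A -> measurable (eta 0%N @^-1` A).
  by move=> mA; rewrite -[X in measurable X]setTI; exact: measurable_funPT.
have mm s := m_eta _ (measurable_side s c).
have mc : measurable (eta 0%N @^-1` [set c]) by exact: m_eta.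
apply/not_existsP => side0.
have {}side0 s : P0 (eta 0%N @^-1` side s c) = 0%E.
  by apply/eqP; rewrite eq_le measure_ge0 andbT leNgt; apply/negP; exact: side0.
have Pc : P0 (eta 0%N @^-1` [set c]) = 0%E.
  apply: (@density_dominates [set c]); first exact: measurable_set1.
  exact: lebesgue_measure_set1.
have : (P0 setT <= 0)%E.
  have -> : (0 = P0 (eta 0%N @^-1` side 1 c) + P0 (eta 0%N @^-1` side (-1) c) +
      P0 (eta 0%N @^-1` [set c]))%E by rewrite !side0 Pc !adde0.
  rewrite (_ : setT = eta 0%N @^-1` side 1 c `|` eta 0%N @^-1` side (-1) c `|`
    eta 0%N @^-1` [set c]).
    apply: (le_trans (measureU2 _ _ _)) => //; first exact: measurableU.
    by rewrite leeD2r// measureU2.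
  apply/seteqP; split=> // w _; rewrite /side /preimage/=.
  have [h|h|->] := ltgtP (eta 0%N w) c; last by right.
    by left; right; rewrite mulN1r opprB subr_gt0.
  by left; left; rewrite mul1r subr_gt0.
by rewrite probability_setT leNgt lte01.
Qed.

(** * The sample: hitting probabilities, convergence for a fixed block, and the infimum over
    blocks *)

Section sample.
Context (disp : measure_display) (Omega : measurableType disp).
Context (P : probability Omega R) (Xs : nat -> {RV P >-> Rinf R}).
Hypothesis Xs_indep : mutually_independent P (fun j => Xs j : Omega -> Rinf R).
Hypothesis Xs_law : forall j A, measurable A ->
  distribution P (Xs j) A = distribution P0 X A.
Variable a : Rinf R.
Hypothesis a_periodic : forall i, a (i + d)%N = a i.

Let mu : probability (Rinf R) R := distribution P0 X.
Let Q (k : nat) : probability 'rV[R]_d R := distribution mu (theta R d k).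
Let Y (k j : nat) : Omega -> 'rV[R]_d := theta R d k \o Xs j.
Let S (k : nat) : set (d.+1.-tuple 'rV[R]_d) :=
  [set t | open_hull (tnth t) (theta R d k a)].

Let mY k j : measurable_fun setT (Y k j).
Proof. exact: measurableT_comp. Qed.

Let indepY k : mutually_independent P (Y k).
Proof. exact: (mutually_independent_comp _ Xs_indep). Qed.

Let lawY k j A : measurable A -> P (Y k j @^-1` A) = Q k A.
Proof.
move=> mA; apply: Xs_law; rewrite -[X in measurable X]setTI.
exact: measurable_theta_fun.
Qed.

Let QE k A : measurable A -> Q k A = Q 0%N A.
Proof.
move=> mA; have E i : Q i A = P0 ((theta R d i \o X) @^-1` A) by [].
by rewrite !E !theta_block_law.
Qed.

Let a_block k i : a (k * d + i)%N = a i.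
Proof. by elim: k => [//|k IH]; rewrite mulSn -addnA addnC a_periodic. Qed.

Let theta_a k : theta R d k a = theta R d 0 a.
Proof. by apply/rowP => i; rewrite !mxE !a_block. Qed.

Let tuple_eventE k (j : 'I_d.+1 -> nat) w :
  tuple_event (Y k) (S k) j w =
  open_hull (fun i => theta R d k (Xs (j i) w)) (theta R d k a).
Proof.
congr (open_hull _ _); apply/funext => i.
exact: (tnth_mktuple (fun i => Y k (j i) w)).
Qed.

Let hit_eventE k u : hit_event d Xs a k u =
  tuple_event (Y k) (S k) (fun i => (u + i)%N).
Proof. by apply/funext => w; rewrite tuple_eventE. Qed.

Let Z_E k n : Z_ d Xs a n k = u_sum R (Y k) (S k) n.
Proof.
apply/funext => w; apply: eq_bigr => j _; rewrite !indicE; congr (_%:R).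
by congr nat_of_bool; apply/idP/idP; rewrite !inE tuple_eventE.
Qed.

(** By unfolding, this is the simplicial depth of the [k]-th block of [a]; [prob_hit] thus turns
    depths into hitting probabilities. *)
Let lam k : R := fine (power_measure (Q k) d.+1 (S k)).

Let mS k : measurable (S k). Proof. exact: measurable_open_hull. Qed.

Let addn_ord_inj u : injective (fun i : 'I_d.+1 => (u + i)%N).
Proof. by move=> i j /= /eqP; rewrite eqn_add2l => /eqP/val_inj. Qed.

Let prob_hit k u : P (hit_event d Xs a k u) = (lam k)%:E.
Proof.
rewrite hit_eventE.
exact: (prob_tuple_event (mY k) (@indepY k) (@lawY k) (mS k) (@addn_ord_inj u)).
Qed.

(** Periodicity of [a] makes [S k] equal to [S 0], and the blocks share one law, so the dependence
    on [k] disappears. *)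
Let prob_hit0 k u : P (hit_event d Xs a k u) = (lam 0)%:E.
Proof.
rewrite hit_eventE (_ : S k = S 0%N); last by rewrite /S theta_a.
apply: (prob_tuple_event (mY k) (@indepY k) _ (mS 0) (@addn_ord_inj u)).
by move=> i A mA; rewrite lawY// QE.
Qed.

Lemma lambda_E : lambda_ d Xs a = lam 0.
Proof. by rewrite /lambda_ prob_hit0. Qed.

Lemma hit_lambda k u : fine (P (hit_event d Xs a k u)) = lambda_ d Xs a.
Proof. by rewrite lambda_E prob_hit0. Qed.

Lemma depth_Theta_lambda :
  depth_Theta (range (theta R d)) a mu =
    inf (range (fun k => fine (P (hit_event d Xs a k 0)))) /\
  inf (range (fun k => fine (P (hit_event d Xs a k 0)))) = lambda_ d Xs a.
Proof.
split.
  rewrite /depth_Theta; congr inf; rewrite image_comp.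
  by congr (_ @` _); apply/funext => k; rewrite prob_hit.
rewrite -[RHS]inf1; congr inf.
apply/seteqP; split=> [_ [k _ <-]|_ ->]; first exact: hit_lambda.
by exists 0%N => //; exact: hit_lambda.
Qed.

Lemma Z_ae_cvg k : {ae P, forall w,
  `|Z_ d Xs a n k w / N_ R d n - lambda_ d Xs a| @[n --> \oo] --> 0}.
Proof.
have := u_sum_ae_cvg (mY k) (@indepY k) (@lawY k) (mS k).
apply: filterS => w.
rewrite -/(lam k).
have -> : lam k = lambda_ d Xs a by rewrite -(hit_lambda k 0) prob_hit.
move=> cvgU; apply/norm_cvg0P/subr_cvg0.
by under eq_cvg do rewrite Z_E.
Qed.

Let coord_law j i A : measurable A ->
  P ((fun w => Xs j w i) @^-1` A) = P0 (eta 0%N @^-1` A).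
Proof.
move=> mA; rewrite -(eta_id i.+1 0%N mA).
have := @Xs_law j ((fun x : Rinf R => x i) @^-1` A).
rewrite -[X in measurable X]setTI => /(_ (@measurable_coord R i measurableT A mA)).
rewrite /distribution /pushforward => ->; congr (P0 _).
by apply/funext => w; rewrite /preimage/= X_eta.
Qed.

(** Independence of the coordinates is a property of the law on sequences, so it passes from [X] to
    [Xs j]. *)
Let coord_indep j :
  mutually_independent P (fun i => (fun x : Rinf R => x i) \o Xs j).
Proof.
move=> J A uJ mA; pose E : set (Rinf R) :=
  \bigcap_(i in [set` J]) ((fun x : Rinf R => x i) @^-1` A i).
have mE : measurable E.
  apply: fin_bigcap_measurable => // i _.
  by rewrite -[X in measurable X]setTI; exact: measurable_coord.
have /(_ J A uJ mA) := mutually_independent_inj succn_inj eta_indep.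
rewrite (_ : \bigcap_(i in [set` J]) (eta i.+1 @^-1` A i) = X @^-1` E); last first.
  by apply/seteqP; split=> w h i iJ; have := h i iJ; rewrite /preimage/= X_eta.
move=> PE; transitivity (distribution P (Xs j) E) => //.
rewrite Xs_law// [LHS]PE; apply: eq_bigr => i _.
by rewrite [RHS]coord_law// (eta_id i.+1 0%N).
Qed.

Let first_coords n k (w : Omega) : n.-tuple R :=
  [tuple Xs j w (k * d)%N | j < n].

Lemma ae_Z_eq0 n : (0 < d)%N ->
  {ae P, forall w, exists k, Z_ d Xs a n k w = 0}.
Proof.
move=> d0; have [s s0] := density_side (a 0%N).
set B := side s (a 0%N) in s0; have mB : measurable B := measurable_side s (a 0%N).
have meB : measurable (eta 0%N @^-1` B).
  by rewrite -[X in measurable X]setTI; exact: measurable_funPT.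
set q := fine (P0 (eta 0%N @^-1` B)).
have qE : P0 (eta 0%N @^-1` B) = q%:E by rewrite fineK// fin_num_measure.
have q0 : 0 < q by rewrite -lte_fin -qE.
have q1 : q <= 1 by rewrite -lee_fin -qE; exact: probability_le1.
pose V (kj : nat * 'I_n) (w : Omega) : R := Xs kj.2 w (kj.1 * d)%N.
have mV kj : measurable_fun setT (V kj).
  exact: (measurableT_comp (@measurable_coord R _)).
have indepV : mutually_independent P V.
  (* All coordinates of all sample points are jointly independent; the first coordinates of the
     blocks form a subfamily, indexed injectively because [d] is positive. *)
  have /(mutually_independent_pair (@measurable_coord R) Xs_indep) := coord_indep.
  apply: (mutually_independent_inj (g := fun kj : nat * 'I_n =>
    (kj.2 : nat, kj.1 * d)%N)) => -[k j] [k' j'] /= [/val_inj -> /eqP].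
  by rewrite eqn_pmul2r// => /eqP ->.
have indepW := mutually_independent_mktuple mV indepV.
pose C : set (n.-tuple R) := box (fun=> B).
have mC : measurable C by exact: measurable_box.
(* The event that the [k]-th block is not one-sided; by independence across blocks, all [F k] hold
   together with probability 0. *)
pose F k := first_coords n k @^-1` ~` C.
have mW k : measurable_fun setT (first_coords n k).
  by apply: measurable_mktuple => j; exact: (mV (k, j)).
have mF k : measurable (F k).
  by rewrite -[F k]setTI; apply: mW => //; exact: measurableC.
have PF k : P (F k) = (1 - q ^+ n)%:E.
  rewrite /F -preimage_setC probability_setC; last first.
    by rewrite -[X in measurable X]setTI; exact: mW.
  rewrite EFinB; congr (_ - _)%E.
  rewrite (@mutually_independent_ord _ _ _ P _ _ n (fun j => V (k, j)) (fun=> B))//.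
    rewrite (eq_bigr (fun=> q%:E)) => [|j _]; last first.
      by rewrite -qE; exact: coord_law.
    by rewrite prodEFin prodr_const card_ord.
  by apply: (mutually_independent_inj _ indepV (g := fun j => (k, j))) => i j [].
have r01 : 0 <= 1 - q ^+ n < 1.
  rewrite subr_ge0 exprn_ile1// ?ltW//= ltrBlDr ltrDl exprn_gt0//.
exists (\bigcap_k F k); split.
- exact: bigcapT_measurable.
- apply: (prob_bigcap_geometric_eq0 mF r01) => K.
  rewrite (indepW _ (fun=> ~` C))//; first last.
  - by move=> _; exact: measurableC.
  - exact: iota_uniq.
  rewrite (eq_bigr (fun=> (1 - q ^+ n)%:E)) => [|k _]; last exact: PF.
  by rewrite prodEFin big_const_seq count_predT size_iota iter_mulr_1.
(* Contrapositive: outside some [F k], the first coordinates of the [k]-th blocks all lie on the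
   chosen side of [a 0], so every summand of [Z_] is 0. *)
move=> w /= Znot k _; apply: contrapT => /contrapT Ckw; apply: Znot.
exists k; apply: big1 => j _; rewrite indicE memNset//.
apply: (@halfspace_notin_open_hull _ _ _ _ _ s (Ordinal d0)) => i.
have := Ckw (j i).
by rewrite !mxE /= !addn0 tnth_mktuple -(addn0 (k * d)%N) a_block addn0.
Qed.

Lemma ae_empirical_depth_eq0 n : (0 < d)%N ->
  {ae P, forall w, empirical_depth d Xs a n w = 0}.
Proof.
move=> /(ae_Z_eq0 n); apply: filterS => w [k Zk].
apply: (@inf_range_eq0 _ _ k); last by rewrite Zk mul0r.
move=> i; rewrite Z_E divr_ge0 ?ler0n//.
exact: u_sum_ge0.
Qed.

End sample.

End blocks.

Theorem proposition6 (R : realType) (d : nat) (d_ge1 : (1 <= d)%N)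
  (* eta 0 is the generic variable; eta 1, eta 2, ... are the coordinates of X *)
  (disp0 : measure_display) (Omega0 : measurableType disp0)
  (P0 : probability Omega0 R) (eta : nat -> {RV P0 >-> R})
  (eta_indep : mutually_independent P0 (fun i => eta i : Omega0 -> R))
  (eta_id : identically_distributed P0 (fun i => eta i : Omega0 -> R))
  (eta_density : has_density P0 (eta 0%N))
  (X : {RV P0 >-> Rinf R}) (X_eta : forall w i, X w i = eta i.+1 w)
  (disp : measure_display) (Omega : measurableType disp)
  (P : probability Omega R) (Xs : nat -> {RV P >-> Rinf R})
  (Xs_indep : mutually_independent P (fun j => Xs j : Omega -> Rinf R))
  (Xs_law : forall j A, measurable A ->
     distribution P (Xs j) A = distribution P0 X A) :
  let mu : probability (Rinf R) R := distribution P0 X in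
  let Theta := range (theta R d) in
  (exists Q : probability 'rV[R]_d R,
    [/\ forall k, measurable_fun setT (theta R d k \o X),
        mutually_independent P0 (fun k => theta R d k \o X),
        forall k A, measurable A -> P0 ((theta R d k \o X) @^-1` A) = Q A &
        Q `<< lebesgue_rV R d]) /\
  (forall a : Rinf R, (forall i, a (i + d)%N = a i) ->
    [/\ forall k u, fine (P (hit_event d Xs a k u)) = lambda_ d Xs a,
        depth_Theta Theta a mu =
          inf (range (fun k => fine (P (hit_event d Xs a k 0)))) /\
        inf (range (fun k => fine (P (hit_event d Xs a k 0)))) = lambda_ d Xs a,
        forall k, {ae P, forall w,
          `|Z_ d Xs a n k w / N_ R d n - lambda_ d Xs a| @[n --> \oo] --> 0},
        forall n, (d.+1 <= n)%N -> {ae P, forall w,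
          `|empirical_depth d Xs a n w - depth_Theta Theta a mu| =
            `|inf (range (fun k => Z_ d Xs a n k w / N_ R d n)) - lambda_ d Xs a| /\
          `|inf (range (fun k => Z_ d Xs a n k w / N_ R d n)) - lambda_ d Xs a| =
            lambda_ d Xs a} &
        0 < lambda_ d Xs a -> {ae P, forall w,
          ~ (empirical_depth d Xs a n w @[n --> \oo] --> depth_Theta Theta a mu)}]).
Proof.
move=> mu Theta.
have PE k A : measurable A ->
    P0 ((theta R d k \o X) @^-1` A) = _ :=
  theta_block_law eta_indep eta_id X_eta k (A := A).
split.
  exists (distribution mu (theta R d 0)); split.
  - exact: measurable_theta_block.
  - exact: (theta_block_indep eta_indep X_eta).
  - by move=> k A mA; rewrite PE// -(PE 0%N).
  - exact: (theta_block_dominated eta_indep eta_id eta_density X_eta).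
move=> a a_per.
have hitE := hit_lambda eta_indep eta_id X_eta Xs_indep Xs_law a_per.
have [depthE infE] :=
  depth_Theta_lambda eta_indep eta_id X_eta Xs_indep Xs_law a_per.
have emp0 n := ae_empirical_depth_eq0 eta_indep eta_id eta_density X_eta
  Xs_indep Xs_law a_per n d_ge1.
have lam_ge0 : 0 <= lambda_ d Xs a by exact: fine_ge0.
split=> //.
- exact: (Z_ae_cvg eta_indep eta_id X_eta Xs_indep Xs_law a_per).
- move=> n _; apply: filterS (emp0 n) => w w0.
  rewrite depthE infE; split=> //.
  by rewrite -/(empirical_depth d Xs a n w) w0 sub0r normrN ger0_norm.
(* The countably many null sets are merged, so the empirical depth is almost surely the zero
   sequence in [n], whose only limit is 0. *)
- move=> lam_gt0; apply: filterS (ae_foralln emp0) => w w0.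
  rewrite depthE infE (funext w0) => lamE.
  have : 0 = lambda_ d Xs a.
    by apply: (cvg_unique _ _ lamE); [exact: norm_hausdorff|exact: cvg_cst].
  by move/eqP; rewrite lt_eqF.
Qed.
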